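(* Let $p>1$ and let $\mathcal{F}$ be a family of domains in $\mathbb{R}^N$ satisfying the following hypotheses: (f1) There exists $R>0$ such that $\Omega\subset B(0,R)$ for every $\Omega\in\mathcal{F}$. (f2) There exist $q>p$ and $C_S>0$ such that for every $\Omega\in\mathcal{F}$ and every $u\in W^{1,p}(\Omega)$, $$\|u\|_{L^q(\Omega)}\le C_S\|u\|_{W^{1,p}(\Omega)}.$$ (f3) For every $\varepsilon>0$ there exists $\delta=\delta(\varepsilon)>0$ such that for every $\Omega\in\mathcal{F}$ one can choose a connected set $U\subset\Omega$ with $U\subset\Omega^{\delta}$ and $|\Omega\setminus U|<\varepsilon$. Then there exists $C>0$ such that for every $\Omega\in\mathcal{F}$, $$\int_{\Omega}|u|^p\,dx\le C\int_{\Omega}|\nabla u|^p\,dx\qquad\text{for all } u\in W^{1,p}(\Omega)\text{ with }\int_\Omega u(x)\,dx=0.$$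
   Context: A domain is a nonempty connected open subset of $\mathbb{R}^N$. $B(0,R)$ is the open Euclidean ball of radius $R$ centred at $0$, $d$ is Euclidean distance, $|\cdot|$ applied to a set is Lebesgue measure, and $\Omega^{\delta}=\{x\in\Omega:\ d(x,\partial\Omega)>\delta\}$. The norm is $\|u\|_{W^{1,p}(\Omega)}=\left(\int_\Omega |u|^p\,dx+\int_\Omega|\nabla u|^p\,dx\right)^{1/p}$. *)

(* Defs.v *)
From HB Require Import structures.
From mathcomp Require Import all_boot all_order all_algebra.
From mathcomp Require Import all_classical all_reals all_analysis.

Set Implicit Arguments.
Unset Strict Implicit.
Unset Printing Implicit Defensive.
Import Order.TTheory GRing.Theory Num.Theory.
Import numFieldNormedType.Exports.

Local Open Scope classical_set_scope.
Local Open Scope ring_scope.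

Fact rV_display : measure_display. Proof. exact: default_measure_display. Qed.

Section rV_measurable.
Context {R : realType} {n : nat}.

Let coord (i : 'I_n) (x : 'rV[R]_n) : measurableTypeR R := x ord0 i.

(* The product sigma-algebra, i.e. the Borel sets of R^n (the open sets are
   measurable by open_measurable_rV). *)
Definition rV_measurable : set (set 'rV[R]_n) := g_sigma_preimage coord.

Let rV0 : rV_measurable set0. Proof. exact: sigma_algebra0. Qed.

Let rVC A : rV_measurable A -> rV_measurable (~` A).
Proof. exact: sigma_algebraC. Qed.

Let rV_bigcup (F : (set 'rV[R]_n)^nat) :
  (forall i, rV_measurable (F i)) -> rV_measurable (\bigcup_i F i).
Proof. exact: sigma_algebra_bigcup. Qed.

HB.instance Definition _ :=
  @isMeasurable.Build rV_display 'rV[R]_n rV_measurable rV0 rVC rV_bigcup.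

End rV_measurable.

Section rV_measurable_lemmas.
Context {R : realType}.

Lemma measurable_coord n (i : 'I_n) :
  measurable_fun setT (fun x : 'rV[R]_n => x ord0 i : measurableTypeR R).
Proof.
move=> _ Y mY; rewrite setTI; apply: sub_sigma_algebra => /=.
rewrite -bigcup_seq/=; exists i => /=; first by rewrite mem_index_enum.
by exists Y => //; rewrite setTI.
Qed.

Lemma measurable_rV d (T : measurableType d) n (f : T -> 'rV[R]_n) :
  (forall i, measurable_fun setT (fun t => f t ord0 i : measurableTypeR R)) ->
  measurable_fun setT f.
Proof.
move=> mf _ A mA; rewrite setTI.
suff /(_ A mA) : (measurable : set (set 'rV[R]_n)) `<=`
    [set B | measurable (f @^-1` B)] by [].
apply: smallest_sub.
  split => /=.
  - by rewrite preimage_set0.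
  - by move=> B mB; rewrite setTD preimage_setC; exact: measurableC.
  - by move=> F mF; rewrite preimage_bigcup; exact: bigcupT_measurable.
move=> B; rewrite -bigcup_seq => -[i _] [C mC <-] /=.
by rewrite setTI -[X in measurable X]setTI; exact: mf.
Qed.

Lemma open_measurable_rV n (U : set 'rV[R]_n) : open U -> measurable U.
Proof.
move=> oU.
pose q2r (q : 'rV[rat]_n) : 'rV[R]_n := map_mx ratr q.
pose B (z : 'rV[rat]_n * nat) : set 'rV[R]_n :=
  [set x | forall i, `|ratr (z.1 ord0 i) - x ord0 i| < z.2.+1%:R^-1].
have -> : U = \bigcup_(z in [set z | B z `<=` U]) B z.
  rewrite eqEsubset; split => [x Ux|x [z zU /zU//]].
  have /nbhs_ballP[e /= e0 eU] : nbhs x U by exact: open_nbhs_nbhs.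
  have [k ke] : exists k : nat, 2 * k.+1%:R^-1 < e.
    exists (Num.truncn (2 / e)).
    by rewrite ltr_pdivrMr// mulrC -ltr_pdivrMr// truncnS_gt.
  have ex i : exists q : rat, `|ratr q - x ord0 i| < k.+1%:R^-1.
    have [q] := @rat_in_itvoo R (x ord0 i - k.+1%:R^-1) (x ord0 i + k.+1%:R^-1)
      ltac:(by rewrite ltrBlDr -addrA ltrDl addr_gt0).
    by rewrite in_itv /= => qx; exists q; rewrite ltr_distl.
  have [q qx] := choice ex.
  exists (\row_i q i, k) => /=; last by move=> i /=; rewrite mxE.
  move=> y By; apply: eU; split => // i j; rewrite ord1 /ball /=.
  apply: lt_trans ke; rewrite mulr_natl mulr2n.
  rewrite -(subrKA (ratr (q j))) (le_lt_trans (ler_normD _ _))// ltrD//.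
    by rewrite distrC.
  by move: (By j); rewrite /= mxE.
rewrite bigcup_mkcond; apply: countable_bigcupT_measurable => [|z].
  exact: countableP.
case: ifP => // _.
have -> : B z = \bigcap_(i in [set: 'I_n])
    ((fun x : 'rV[R]_n => x ord0 i : measurableTypeR R) @^-1`
      (ball (ratr (z.1 ord0 i) : R) z.2.+1%:R^-1)).
  by rewrite eqEsubset; split=> [x Bx i _|x Bx i]; [exact: Bx|exact: Bx i I].
apply: fin_bigcap_measurable => // i _.
rewrite -[X in measurable X]setTI; apply: measurable_coord => //.
exact: measurable_realfun.measurable_ball.
Qed.

End rV_measurable_lemmas.

Section lebesgue_rV.
Context {R : realType}.

Definition rV_rcons n (z : 'rV[R]_n * measurableTypeR R) : 'rV[R]_n.+1 :=
  \row_i (if unlift ord_max i is Some j then z.1 ord0 j else z.2).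

Lemma measurable_rV_rcons n : measurable_fun setT (@rV_rcons n).
Proof.
apply: measurable_rV => i; case E : (unlift ord_max i) => [j|].
  under eq_fun do rewrite mxE E.
  exact: (measurableT_comp (measurable_coord j) measurable_fst).
under eq_fun do rewrite mxE E.
exact: measurable_snd.
Qed.

(* mu \x lebesgue_measure, transported from R^n * R to R^n.+1. *)
Definition leb_step n (mu : {measure set 'rV[R]_n -> \bar R}) :=
  pushforward (mu \x lebesgue_measure)%E (@rV_rcons n).

Section leb_step.
Variables (n : nat) (mu : {measure set 'rV[R]_n -> \bar R}).
Local Open Scope ereal_scope.

Let leb_step0 : leb_step mu set0 = 0.
Proof. by rewrite /leb_step /pushforward preimage_set0 measure0. Qed.

Let leb_step_ge0 A : 0 <= leb_step mu A.
Proof. by rewrite /leb_step /pushforward measure_ge0. Qed.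

Let leb_step_sigma_additive : semi_sigma_additive (leb_step mu).
Proof.
move=> F mF tF mUF; rewrite /leb_step /pushforward preimage_bigcup.
have mpre A : measurable A -> measurable (@rV_rcons n @^-1` A).
  by move=> mA; rewrite -[X in measurable X]setTI; exact: measurable_rV_rcons.
apply: measure_semi_sigma_additive.
- by move=> k; exact: mpre.
- apply/trivIsetP => /= i j _ _ ij; rewrite -preimage_setI.
  by move/trivIsetP : tF => /(_ _ _ _ _ ij) ->//; rewrite preimage_set0.
- by rewrite -preimage_bigcup; exact: mpre.
Qed.

HB.instance Definition _ := isMeasure.Build _ _ _ (leb_step mu)
  leb_step0 leb_step_ge0 leb_step_sigma_additive.

End leb_step.

(* Lebesgue measure on R^n; R^0 is a point, of mass 1. *)
Fixpoint leb n : {measure set 'rV[R]_n -> \bar R} :=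
  match n with
  | 0 => \d_(0 : 'rV[R]_0)
  | m.+1 => leb_step (leb m)
  end.

Lemma leb_box n (a b : 'rV[R]_n) : (forall i, a ord0 i <= b ord0 i) ->
  leb n [set x | forall i, a ord0 i < x ord0 i <= b ord0 i] =
  (\prod_i (b ord0 i - a ord0 i))%:E.
Proof.
elim: n a b => [|n IHn] a b ab.
  by rewrite /= diracE big_ord0 mem_set//= => -[].
have meas m (c d : 'rV[R]_m) :
    measurable [set x : 'rV[R]_m | forall i, c ord0 i < x ord0 i <= d ord0 i].
  have -> : [set x : 'rV[R]_m | forall i, c ord0 i < x ord0 i <= d ord0 i] =
      \bigcap_(i in [set: 'I_m])
        ((fun x : 'rV[R]_m => x ord0 i : measurableTypeR R) @^-1`
          `]c ord0 i, d ord0 i]).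
    rewrite eqEsubset; split=> [x Bx i _|x Bx i].
      by rewrite /= in_itv /= Bx.
    by have := Bx i I; rewrite /= in_itv.
  apply: fin_bigcap_measurable => // i _.
  rewrite -[X in measurable X]setTI.
  exact (measurable_coord (R:=R) i measurableT (measurable_itv `]c ord0 i, d ord0 i])).
pose cut (c : 'rV[R]_n.+1) : 'rV[R]_n := \row_i c ord0 (lift ord_max i).
rewrite /= /leb_step /pushforward.
have -> : @rV_rcons n @^-1` [set x | forall i, a ord0 i < x ord0 i <= b ord0 i] =
    [set x : 'rV[R]_n | forall i, cut a ord0 i < x ord0 i <= cut b ord0 i] `*`
    (`]a ord0 ord_max, b ord0 ord_max]%classic : set (measurableTypeR R)).
  rewrite eqEsubset; split=> -[v t] /=.
    move=> h; split=> [i|].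
      by have := h (lift ord_max i); rewrite !mxE liftK.
    by have := h ord_max; rewrite mxE unlift_none in_itv.
  move=> [h1 h2] i; rewrite mxE; case: unliftP => [j ->|->].
    by have := h1 j; rewrite !mxE.
  by move: h2; rewrite in_itv.
rewrite product_measure1E; first last.
- exact (measurable_itv `]a ord0 ord_max, b ord0 ord_max]).
- exact: meas.
rewrite IHn; last by move=> i; rewrite !mxE.
have lebE : lebesgue_measure
    (`]a ord0 ord_max, b ord0 ord_max]%classic : set (measurableTypeR R)) =
    (b ord0 ord_max - a ord0 ord_max)%:E.
  rewrite lebesgue_measure_itv /= lte_fin; case: ifPn => // /negbTE nab.
  congr EFin; apply/esym/eqP.
  by rewrite subr_eq0 eq_le ab andbT leNgt nab.
rewrite [X in (_ * X)%E]lebE.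
rewrite -EFinM big_ord_recr /=; congr (_ * _)%:E.
have liftE i : lift ord_max i = widen_ord (leqnSn n) i.
  by apply: val_inj; exact: lift_max.
by apply: eq_bigr => i _; rewrite !mxE liftE.
Qed.

End lebesgue_rV.

Section sobolev.
Context {R : realType} {N : nat}.
Implicit Types (Omega : set 'rV[R]_N) (p : R) (u phi : 'rV[R]_N -> R).

Definition domain Omega := [/\ Omega !=set0, connected Omega & open Omega].

(* The library norm on 'rV[R]_N is the sup norm: same topology, other balls. *)
Definition enorm (x : 'rV[R]_N) : R := Num.sqrt (\sum_i x ord0 i ^+ 2).

Definition eball0 (r : R) : set 'rV[R]_N := [set x | enorm x < r].

Definition edist_set (x : 'rV[R]_N) (A : set 'rV[R]_N) : \bar R :=
  ereal_inf [set (enorm (x - y))%:E | y in A].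

Definition boundary (A : set 'rV[R]_N) := closure A `\` interior A.

Definition inner_part Omega (delta : R) : set 'rV[R]_N :=
  [set x | Omega x /\ (delta%:E < edist_set x (boundary Omega))%E].

(* The Lebesgue measure of a set not required to be Borel: the outer measure,
   which is the Lebesgue measure on all Lebesgue measurable sets. *)
Definition vol (A : set 'rV[R]_N) : \bar R := mu_ext (leb N) A.

Definition partial (i : 'I_N) phi : 'rV[R]_N -> R :=
  fun x => 'D_(delta_mx ord0 i) phi x.

Definition smooth phi := forall s : seq 'I_N,
  continuous (foldr partial phi s) /\
  forall i x, derivable (foldr partial phi s) x (delta_mx ord0 i).

Definition test_function Omega phi :=
  [/\ smooth phi, compact (closure [set x | phi x != 0])
    & closure [set x | phi x != 0] `<=` Omega].

Definition weak_partial Omega u (i : 'I_N) (g : 'rV[R]_N -> R) :=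
  forall phi, test_function Omega phi ->
    \int[leb N]_(x in Omega) (u x * partial i phi x) =
    - \int[leb N]_(x in Omega) (g x * phi x).

Definition LpNorm Omega p u : \bar R := 'N[leb N]_p%:E[EFin \o (u \_ Omega)].

Definition in_Lp Omega p u :=
  measurable_fun Omega u /\ (LpNorm Omega p u < +oo)%E.

(* An element of W^{1,p}(Omega) is given by a function u together with its weak
   gradient Du, which is unique up to a null set, so that quantities computed
   from Du do not depend on its choice. Functions are total on R^N; only their
   values on Omega matter. *)
Definition W1p Omega p u (Du : 'rV[R]_N -> 'rV[R]_N) :=
  in_Lp Omega p u /\
  forall i, in_Lp Omega p (fun x => Du x ord0 i) /\
            weak_partial Omega u i (fun x => Du x ord0 i).

Definition W1pNorm Omega p u (Du : 'rV[R]_N -> 'rV[R]_N) : \bar R :=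
  ((\int[leb N]_(x in Omega) (`|u x| `^ p)%:E +
    \int[leb N]_(x in Omega) (enorm (Du x) `^ p)%:E) `^ p^-1)%E.

End sobolev.

(* Main.v *)
From HB Require Import structures.
Require Import Defs.
From mathcomp Require Import all_boot all_order all_algebra.
From mathcomp Require Import all_classical all_reals all_analysis.
From mathcomp Require Import ring lra.
From mathcomp Require Import measurable_realfun.

(** Fix a domain [Omega] of the family and [u]
    with weak gradient [Du]; extend both by 0. For a suitable constant [k] and
    [w = u - k] the integral [X] of [|w| ^ p] is bounded by a multiple of the integral
    [Y] of [|Du| ^ p]; since [u] has mean zero, [k] is itself controlled by the mean
    of [|w|], and the claim for [u] follows ([mean_zero_estimate]).

    By the third hypothesis, up to a set of small volume [Omega] is covered by cubes of
    a fixed radius [r] that are centred at points of a connected set [U] and stay inside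
    [Omega] when enlarged ([inner_part_cube]). On one such cube a local Poincare
    inequality gives [k] ([poincare_cube]). Any two points of [U] are joined by a chain
    of points of [U] with small steps, whose length is bounded because [Omega] lies in a
    fixed ball ([chain_propagation]), and each step moves the cube without changing [k]
    ([cube_move]). Summing over boundedly many cubes gives a set [V] that contains [U],
    on which the integral of [|w| ^ p] is at most [C Y], with [C] depending only on the
    dimension, [p], [r] and the radius of the ball ([poincare_connected]).

    On the small set [Omega \ V] the Sobolev inequality, applied to [w], bounds the
    integral of [|w| ^ q] by a power of [X + Y]. Cutting at a level proportional to
    [(X + Y) ^ (1 / p)] bounds the integral of [|w| ^ p] over [Omega \ V] by
    [(X + Y) / 2] as soon as the volume is small enough ([tail_estimate],
    [absorb_tail]). Hence [X <= C Y + (X + Y) / 2], which is the desired bound, as [X]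
    is finite.

    Both [poincare_cube] and [cube_move] rest on one fact about weak derivatives: for a
    box that stays well inside [Omega] when it is moved by [h > 0] along the axis [e], the
    [L^p] norm
    of [v (x + h e) - v x] over the box is at most [2 h] times the [L^p] norm of the
    weak derivative ([translation_estimate_coord]). It follows from the formula
    [v (x + h e) - v x = \int_0^h g (x + t e) dt], valid for almost every [x]
    ([ae_eq_weak_difference]). To prove the formula, test the definition of the weak
    derivative against [\int_0^h phi (x - t e) dt], whose derivative is
    [phi x - phi (x - h e)], let [phi] tend to the indicator of a box, and note that
    integrals over boxes determine a function almost everywhere. Only products of
    smooth bumps of one variable are used as [phi]. *)

Set Implicit Arguments.
Unset Strict Implicit.
Unset Printing Implicit Defensive.

Import Order.TTheory GRing.Theory Num.Theory.
Import numFieldNormedType.Exports.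

Local Open Scope classical_set_scope.
Local Open Scope ring_scope.

(** * Lebesgue measure on boxes and under translations *)

Section boxes.
Context {R : realType} {n : nat}.
Implicit Types (a b x y z : 'rV[R]_n) (A : set 'rV[R]_n).

(** Half-open boxes rather than balls: they are closed under intersection, they
    generate the Borel sets, and their Lebesgue measure is a plain product. *)
Definition rbox a b : set 'rV[R]_n :=
  [set x | forall i, a ord0 i < x ord0 i <= b ord0 i].

Lemma measurable_rbox a b : measurable (rbox a b).
Proof.
have -> : rbox a b = \bigcap_(i in [set: 'I_n])
    ((fun x : 'rV[R]_n => x ord0 i : measurableTypeR R) @^-1`
      `]a ord0 i, b ord0 i]).
  rewrite eqEsubset; split=> [x Bx i _|x Bx i].
    by rewrite /= in_itv /= Bx.
  by have := Bx i I; rewrite /= in_itv.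
apply: fin_bigcap_measurable => // i _.
rewrite -[X in measurable X]setTI.
exact (measurable_coord (R:=R) i measurableT
  (measurable_itv `]a ord0 i, b ord0 i])).
Qed.

Definition rboxes : set (set 'rV[R]_n) := [set A | exists a b, A = rbox a b].

Lemma rbox_setI a b (c d : 'rV[R]_n) : rbox a b `&` rbox c d =
  rbox (\row_i Num.max (a ord0 i) (c ord0 i)) (\row_i Num.min (b ord0 i) (d ord0 i)).
Proof.
rewrite eqEsubset; split=> [x [h1 h2] i|x h].
  rewrite !mxE gt_max le_min.
  by case/andP: (h1 i) => -> ->; case/andP: (h2 i) => -> ->.
split=> i; have := h i; rewrite !mxE gt_max le_min.
  by move=> /andP[/andP[-> _] /andP[-> _]].
by move=> /andP[/andP[_ ->] /andP[_ ->]].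
Qed.

Lemma rboxes_setI : setI_closed rboxes.
Proof. by move=> _ _ [a [b ->]] [c [d ->]]; rewrite rbox_setI; do 2 eexists. Qed.

(** An exhaustion of the space by boxes of finite measure. *)
Definition cube (k : nat) := rbox (const_mx (- k%:R)) (const_mx k%:R).

Lemma in_cube x (k : nat) : (forall i, `|x ord0 i| < k%:R) -> cube k x.
Proof. by move=> h i; rewrite !mxE; have := h i; rewrite ltr_norml => /andP[-> /ltW]. Qed.

Lemma coord_lt_nat x : exists k : nat, forall i, `|x ord0 i| < k%:R.
Proof.
exists (Num.truncn (\sum_i `|x ord0 i|)).+1 => i.
apply: le_lt_trans (truncnS_gt _).
by rewrite (bigD1 i)//= lerDl sumr_ge0.
Qed.

Lemma bigcup_cube : \bigcup_k cube k = [set: 'rV[R]_n].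
Proof.
rewrite -subTset => x _; have [k xk] := coord_lt_nat x.
by exists k => //; exact: in_cube.
Qed.

(** The Borel sets are generated by the preimages of intervals under coordinates;
    such a slab is a countable union of boxes. *)
Lemma measurable_rV_rbox :
  (measurable : set (set 'rV[R]_n)) = <<s rboxes >>.
Proof.
rewrite eqEsubset; split; last first.
  apply: smallest_sub; first exact: sigma_algebra_measurable.
  by move=> _ [a [b ->]]; exact: measurable_rbox.
apply: smallest_sub; first exact: smallest_sigma_algebra.
move=> B; rewrite -bigcup_seq => -[i _] [C mC <-] /=; rewrite setTI.
suff /(_ C mC) : (measurable : set (set (measurableTypeR R))) `<=`
    [set D | <<s rboxes >> ((fun x : 'rV[R]_n => x ord0 i) @^-1` D)] by [].
apply: smallest_sub.
  split => /=.
  - by rewrite preimage_set0; exact: sigma_algebra0.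
  - move=> D mD; rewrite setTD preimage_setC.
    exact: sigma_algebraC mD.
  - by move=> F mF; rewrite preimage_bigcup; exact: sigma_algebra_bigcup.
move=> _ [[c d] _ <-] /=.
pose a (k : nat) : 'rV[R]_n := \row_j (if j == i then c else - k%:R).
pose b (k : nat) : 'rV[R]_n := \row_j (if j == i then d else k%:R).
have -> : (fun x : 'rV[R]_n => x ord0 i) @^-1` `]c, d]%classic =
    \bigcup_k rbox (a k) (b k).
  rewrite eqEsubset; split=> [x /=|x [k _ /(_ i)]].
    rewrite in_itv /= => xcd; have [k xk] := coord_lt_nat x.
    exists k => // j; rewrite !mxE; case: eqP => [->//|_].
    by have := xk j; rewrite ltr_norml => /andP[-> /ltW].
  by rewrite !mxE eqxx /= in_itv.
apply: sigma_algebra_bigcup => k; apply: sub_sigma_algebra.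
by exists (a k), (b k).
Qed.

Lemma leb_rbox a b :
  leb n (rbox a b) = (\prod_i Num.max 0 (b ord0 i - a ord0 i))%:E.
Proof.
have [/existsP[i bai]|/existsPn ab] :=
    boolP [exists i, b ord0 i < a ord0 i].
  have -> : rbox a b = set0.
    rewrite -subset0 => x /(_ i) /andP[ax xb].
    by have := lt_le_trans ax xb; rewrite ltNge (ltW bai).
  rewrite measure0 (bigD1 i)//= (max_idPl _) ?mul0r//.
  by rewrite subr_le0 ltW.
rewrite leb_box => [|i]; last by rewrite leNgt ab.
congr EFin; apply: eq_bigr => i _; rewrite (max_idPr _)//.
by rewrite subr_ge0 leNgt ab.
Qed.

Lemma leb_rbox_lty a b : (leb n (rbox a b) < +oo)%E.
Proof. by rewrite leb_rbox ltry. Qed.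

(** Boxes form a generating pi-system. *)
Lemma measure_eq_rbox (m1 m2 : {measure set 'rV[R]_n -> \bar R}) :
  (forall a b, m1 (rbox a b) = m2 (rbox a b)) ->
  (forall a b, (m1 (rbox a b) < +oo)%E) ->
  forall A, measurable A -> m1 A = m2 A.
Proof.
move=> m12 m1oo A mA.
apply: (@measure_unique _ _ _ rboxes cube) => //.
- exact: measurable_rV_rbox.
- exact: rboxes_setI.
- by move=> k; exists (const_mx (- k%:R)), (const_mx k%:R).
- exact: bigcup_cube.
- by move=> _ [a [b ->]].
- by move=> k; exact: m1oo.
Qed.

Lemma measurable_shift z : measurable_fun setT (fun x : 'rV[R]_n => x + z).
Proof.
apply: measurable_rV => i.
under eq_fun do rewrite mxE.
exact: measurable_funD (measurable_coord i) (measurable_cst (z ord0 i : R)).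
Qed.

Lemma preimage_shift_rbox a b z :
  (fun x => x + z) @^-1` rbox a b = rbox (a - z) (b - z).
Proof.
by rewrite eqEsubset; split=> x h i; have := h i; rewrite /= !mxE;
  rewrite ltrBlDr lerBrDr.
Qed.

Lemma leb_shift z A : measurable A -> leb n ((fun x => x + z) @^-1` A) = leb n A.
Proof.
move=> mA; rewrite -/(pushforward (leb n) (fun x : 'rV[R]_n => x + z) A).
(* found in the context when the pushforward is recognised as a measure *)
pose mz := measurable_shift z.
have -> : pushforward (leb n) (fun x : 'rV[R]_n => x + z) A =
  [the {measure set 'rV[R]_n -> \bar R} of
    pushforward (leb n) (fun x : 'rV[R]_n => x + z)] A by [].
apply: measure_eq_rbox => // a b /=; rewrite /pushforward preimage_shift_rbox.
  rewrite !leb_rbox; congr EFin; apply: eq_bigr => i _; rewrite !mxE.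
  by rewrite opprB addrA subrK.
exact: leb_rbox_lty.
Qed.

End boxes.

Section shift_integral.
Context {R : realType} {n : nat}.
Implicit Types (z : 'rV[R]_n) (A : set 'rV[R]_n).

(** The measure [leb n] as a sigma-finite measure: the Fubini theorems find this
    structure on the constant, and [sleb n] is convertible to [leb n]. *)
Definition sleb : set 'rV[R]_n -> \bar R := leb n.

HB.instance Definition _ := Measure.on sleb.

Lemma sleb_sigma_finite : sigma_finite setT sleb.
Proof.
exists cube; first by rewrite bigcup_cube.
by move=> k; split; [exact: measurable_rbox|exact: leb_rbox_lty].
Qed.

HB.instance Definition _ := Measure_isSigmaFinite.Build _ _ _ sleb sleb_sigma_finite.

Lemma measurable_preimage_shift z A :
  measurable A -> measurable ((fun x => x + z)%R @^-1` A).
Proof. by move=> mA; rewrite -[X in measurable X]setTI; exact: measurable_shift. Qed.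

Lemma ge0_integral_shift z A (f : 'rV[R]_n -> \bar R) : measurable A ->
  measurable_fun A f -> (forall x, A x -> (0 <= f x)%E) ->
  (\int[leb n]_(x in (fun x => x + z)%R @^-1` A) f (x + z)%R = \int[leb n]_(x in A) f x)%E.
Proof.
move=> mA mf f0.
rewrite -[LHS](ge0_integral_pushforward (measurable_shift z))//; last first.
  by move=> x; rewrite inE; exact: f0.
apply: eq_measure_integral; first exact: measurable_shift.
by move=> mz B mB _; exact: leb_shift.
Qed.

Lemma integrable_shift z A (f : 'rV[R]_n -> \bar R) : measurable A ->
  (leb n).-integrable A f ->
  (leb n).-integrable ((fun x => x + z)%R @^-1` A) (fun x => f (x + z)).
Proof.
move=> mA /integrableP[mf foo]; apply/integrableP; split.
  apply: (@measurable_comp _ _ _ _ _ _ A) => //.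
  - by move=> _ [x /= Ax <-].
  - by apply: measurable_funTS; exact: measurable_shift.
rewrite (@ge0_integral_shift z A (fun x => `|f x|%E) mA)//.
exact: measurableT_comp.
Qed.

Lemma integral_shift z A (f : 'rV[R]_n -> \bar R) : measurable A ->
  (leb n).-integrable A f ->
  (\int[leb n]_(x in (fun x => x + z)%R @^-1` A) f (x + z)%R = \int[leb n]_(x in A) f x)%E.
Proof.
move=> mA intf; have mf := measurable_int _ intf.
rewrite integralE [RHS]integralE.
rewrite -(ge0_integral_shift z mA (measurable_funepos mf))//.
rewrite -(ge0_integral_shift z mA (measurable_funeneg mf)) => [|x _]; last exact: funeneg_ge0.
by congr (_ - _)%E; apply: eq_integral => x _; rewrite ?funeposE ?funenegE.
Qed.

Lemma measurable_shift_line z : measurable_fun setT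
  (fun w : 'rV[R]_n * measurableTypeR R => w.1 + w.2 *: z).
Proof.
apply: measurable_rV => i.
under eq_fun do rewrite !mxE.
apply: measurable_funD.
  exact: measurableT_comp (measurable_coord i) measurable_fst.
by apply: measurable_funM => //; exact: measurable_snd.
Qed.

End shift_integral.

(** * Smooth bump functions on the line *)

Section smooth1.
Context {R : realType}.
Implicit Types (f g : R -> R) (k : nat) (a b x t : R) (P : {poly R}).

(** Derivatives are quantified rather than computed by the derivation operator, so
    that closure properties follow by exhibiting them. *)
Fixpoint differentiable_upto k f : Prop :=
  if k is k'.+1 then exists2 g, (forall x, is_derive x 1 f (g x)) &
    differentiable_upto k' g else True.

Definition smooth1 f := forall k, differentiable_upto k f.

Lemma differentiable_uptoS k f :
  differentiable_upto k.+1 f -> differentiable_upto k f.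
Proof.
elim: k f => //= k IH f [g fg [h gh hk]]; exists g => //.
by apply: IH; exists h.
Qed.

Lemma differentiable_uptoD k f g : differentiable_upto k f ->
  differentiable_upto k g -> differentiable_upto k (f + g).
Proof.
elim: k f g => //= k IH f g [f' ff' f'k] [g' gg' g'k].
by exists (f' + g') => [x|]; [exact: is_deriveD|exact: IH].
Qed.

(** The derivative of a product is again a sum of products of functions with one
    derivative fewer. *)
Lemma differentiable_uptoM k f g : differentiable_upto k f ->
  differentiable_upto k g -> differentiable_upto k (f * g).
Proof.
elim: k f g => //= k IH f g fk gk.
have fk' := differentiable_uptoS (k := k) fk.
have gk' := differentiable_uptoS (k := k) gk.
case: fk gk => [f' ff' f'k] [g' gg' g'k].
exists (f * g' + g * f') => [x|].
  by have := is_deriveM (ff' x) (gg' x).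
by apply: differentiable_uptoD; apply: IH.
Qed.

Lemma is_derive_affine a b x : is_derive x 1 (fun y => a * y + b) a.
Proof.
have -> : (fun y => a * y + b) = horner (a *: 'X + b%:P).
  by apply/funext => y; rewrite !hornerE.
have := is_derive_poly (a *: 'X + b%:P) x.
by rewrite derivD derivZ derivX derivC addr0 hornerZ hornerC mulr1.
Qed.

Lemma differentiable_upto_affine k f a b : differentiable_upto k f ->
  differentiable_upto k (fun x => f (a * x + b)).
Proof.
elim: k f => //= k IH f [g fg gk].
exists ((fun=> a) * (fun x => g (a * x + b))) => [x|].
  have := @is_derive1_comp _ f (fun y => a * y + b) x _ _ (fg (a * x + b)) (is_derive_affine a b x).
  by rewrite mulrC.
apply: differentiable_uptoM; last exact: IH.
case: k {IH g fg gk} => //= k; exists (fun=> 0); first by move=> x; exact: is_derive_cst.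
by elim: k => //= k IHk; exists (fun=> 0) => // x; exact: is_derive_cst.
Qed.

Lemma smooth1_affine f a b : smooth1 f -> smooth1 (fun x => f (a * x + b)).
Proof. by move=> sf k; exact: differentiable_upto_affine. Qed.

Lemma smooth1M f g : smooth1 f -> smooth1 g -> smooth1 (f * g).
Proof. by move=> sf sg k; exact: differentiable_uptoM. Qed.

Lemma smooth1D f g : smooth1 f -> smooth1 g -> smooth1 (f + g).
Proof. by move=> sf sg k; exact: differentiable_uptoD. Qed.

Lemma smooth1N f : smooth1 f -> smooth1 (- f).
Proof.
move=> sf k; elim: k f {sf}(sf k) => //= k IH f [g fg gk].
by exists (- g) => [x|]; [exact: is_deriveN|exact: IH].
Qed.

Lemma smooth1_is_derive f x : smooth1 f -> is_derive x 1 f (f^`()%classic x).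
Proof.
move=> /(_ 1%N)[g fg _]; apply: DeriveDef; first exact: ex_derive.
by rewrite derive1E.
Qed.

Lemma smooth1_continuous f : smooth1 f -> continuous f.
Proof.
move=> sf x; apply/differentiable_continuous/derivable1_diffP.
exact: (@ex_derive _ _ _ _ _ _ _ (smooth1_is_derive x sf)).
Qed.

Lemma smooth1_derive1 f : smooth1 f -> smooth1 f^`()%classic.
Proof.
move=> sf k; have [g fg gk] := sf k.+1.
suff -> : f^`()%classic = g by [].
by apply/funext => x; rewrite derive1E; apply: derive_val.
Qed.

Lemma smooth1_antiderivative f F : (forall x, is_derive x 1 F (f x)) ->
  smooth1 f -> smooth1 F.
Proof. by move=> Ff sf [//|k]; exists f. Qed.

(** The exponential beats every polynomial; the factor [x ^+ m] makes the induction
    on [P] go through and later absorbs powers of [1 / x]. *)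
Lemma poly_le_expR P (m : nat) : exists C, forall x, 0 <= x ->
  x ^+ m * `|P.[x]| <= C * expR x.
Proof.
elim/poly_ind: P m => [|P c IH] m.
  by exists 0 => x _; rewrite horner0 normr0 mulr0 mul0r.
have [C HC] := IH m.+1.
exists (C + `|c| * m%:R ^+ m) => x x0.
rewrite !hornerE (le_trans (ler_wpM2l _ (ler_normD _ _))) ?exprn_ge0//.
rewrite mulrDr mulrDl lerD//.
  by rewrite normrM (ger0_norm x0) mulrA mulrAC -exprSr HC.
rewrite mulrC -mulrA ler_wpM2l//.
case: m {C HC} => [|m]; first by rewrite !expr0 mul1r (le_trans _ (expR_ge1Dx x))// lerDl.
have -> : expR x = expR (x / m.+1%:R) ^+ m.+1.
  by rewrite -expRM_natl -[_ *+ _]mulr_natl mulrCA divff ?mulr1.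
rewrite -exprMn ler_pXn2r ?nnegrE ?mulr_ge0 ?expR_ge0//.
rewrite mulrC -ler_pdivrMr ?ltr0n//.
by rewrite (le_trans _ (expR_ge1Dx _))// lerDr.
Qed.

(** The classical flat function [exp (-1/x)], with a polynomial factor in [1/x]:
    this family is stable under derivation. *)
Definition flat P x := if 0 < x then P.[x^-1] * expR (- x^-1) else 0.

(** Away from 0 this is the chain rule; at 0 the difference quotient is
    [P.[1/h] exp (-1/h) / h], which is [O(h)]. *)
Lemma is_derive_flat P x :
  is_derive x 1 (flat P) (flat ('X^2 * (P - P^`())) x).
Proof.
have [x0|x0|->] := ltgtP x 0.
- have -> : flat ('X^2 * (P - P^`())) x = 0 by rewrite /flat ltNge ltW.
  apply: (@near_eq_is_derive _ _ _ (cst 0)).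
  near=> y; rewrite /flat ltNge ltW//=.
  by near: y; exact: lt_nbhsl.
- have dV : is_derive x 1 (fun y : R => y^-1) (- x ^- 2).
    have := @is_deriveV _ id x 1 1 (lt0r_neq0 x0) (is_derive_id _ _).
    by rewrite -[_ *: _]/(- x ^- 2 * 1) mulr1.
  have dP := is_derive1_comp (is_derive_poly P x^-1) dV.
  have dE := @is_derive1_comp _ expR (fun y => - y^-1) x _ _
    (is_derive_expR (- x^-1)) (is_deriveN dV).
  have -> : flat ('X^2 * (P - P^`())) x = P.[x^-1] * (expR (- x^-1) * (x ^- 2))
      + expR (- x^-1) * (P^`().[x^-1] * - x ^- 2).
    by rewrite /flat x0 !hornerE exprVn /=; ring.
  have dPE := is_deriveM dP dE; rewrite opprK in dPE.
  apply: near_eq_is_derive dPE.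
  near=> y; rewrite /flat (_ : 0 < y)//.
  by near: y; exact: lt_nbhsr.
- have -> : flat ('X^2 * (P - P^`())) 0 = 0 by rewrite /flat ltxx.
  have [C HC] := poly_le_expR P 2.
  have key : (h^-1 *: ((flat P \o shift 0) (h *: 1) - flat P 0)) @[h --> 0^'] --> (0 : R).
    apply: (@cvg_to_0_linear _ _ C 1) => // h /andP[h0 _].
    rewrite /= addr0 -[h *: 1]/(h * 1) mulr1 /flat ltxx subr0.
    have {}h0 : h != 0 by rewrite -normr_gt0.
    case: ifPn => hp; last first.
      rewrite scaler0 normr0 mulr_ge0//.
      have := HC 0 (lexx _); rewrite expR0 mulr1 expr2 !mul0r => C0; exact: C0.
    have hV : 0 <= h^-1 by rewrite invr_ge0 ltW.
    rewrite -[_ *: _]/(_ * _) !normrM (ger0_norm hV) (gtr0_norm hp).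
    rewrite (ger0_norm (expR_ge0 _)) expRN mulrA ler_pdivrMr ?expR_gt0//.
    rewrite mulrAC -ler_pdivrMr// (le_trans _ (HC _ hV))// expr2.
    by rewrite mulrAC.
  apply: DeriveDef; first by apply/cvg_ex; exists 0.
  exact: cvg_lim key.
Unshelve. all: by end_near. Qed.

Lemma smooth1_flat P : smooth1 (flat P).
Proof.
move=> k; elim: k P => //= k IH P.
by exists (flat ('X^2 * (P - P^`()))) => // x; exact: is_derive_flat.
Qed.

End smooth1.

Section bump1.
Context {R : realType}.
Implicit Types (f F : R -> R) (k : nat) (a b x s h t eta : R).
Notation mu := (@lebesgue_measure R).

Lemma continuous_itv_integrable f a b : continuous f ->
  mu.-integrable `[a, b] (EFin \o f).
Proof.
move=> cf; apply: continuous_compact_integrable; first exact: segment_compact.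
exact: continuous_subspaceT.
Qed.

(** An integral starting before the support of [f]; it is differentiated by the
    fundamental theorem on the right of its origin, and vanishes on the left
    of [a]. *)
Lemma exists_antiderivative f a : continuous f -> (forall x, x <= a -> f x = 0) ->
  exists F, (forall x, is_derive x 1 F (f x)) /\ (forall x, x <= a -> F x = 0).
Proof.
move=> cf fa; pose F s := (\int[mu]_(t in `[(a - 1)%R, s]) f t)%R.
have F0 s : s <= a -> F s = 0.
  move=> sa; rewrite /F /Rintegral integral0_eq// => t.
  rewrite /= in_itv /= => /andP[_ ts].
  by rewrite fa// (le_trans ts).
exists F; split => // s; have [sa|sa] := ltP s a.
  rewrite fa ?(ltW sa)//; apply: (@near_eq_is_derive _ _ _ (cst 0)).
  near=> y; rewrite F0//= ltW//.
  by near: y; exact: lt_nbhsl.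
have [] := @continuous_FTC1 R f (BLeft (a - 1)) s (s + 1) _ _ _ (cf s).
- by rewrite ltrDl.
- exact: continuous_itv_integrable.
- by rewrite lte_fin (lt_le_trans _ sa)// ltrBlDr ltrDl.
move=> dF F'; apply: DeriveDef => //.
by rewrite -F' derive1E.
Unshelve. all: by end_near. Qed.

(** The left side is how this increment of [F] arises from translates of [f]; the
    right side shows that it is smooth in [s]. *)
Lemma integral_window f F s h : 0 < h -> continuous f ->
  (forall x, is_derive x 1 F (f x)) ->
  (\int[mu]_(t in `[0%R, h]) (f (s - t)%R)%:E = (F s - F (s - h)%R)%:E)%E.
Proof.
move=> h0 cf dF.
have cs : continuous (fun t => s - t).
  by move=> t; apply: cvgB; [exact: cvg_cst|exact: cvg_id].
have dG t : is_derive t 1 (fun t => - F (s - t)) (f (s - t)).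
  have ds : is_derive t 1 (fun t => s - t) (-1).
    have := is_deriveB (is_derive_cst s t 1) (is_derive_id t (1:R)).
    by rewrite sub0r.
  have := is_deriveN (@is_derive1_comp _ F (fun t => s - t) t _ _ (dF _) ds).
  by rewrite mulrN1 opprK.
rewrite (@continuous_FTC2 _ (fun t => f (s - t)) (fun t => - F (s - t)) 0 h)//.
- by rewrite subr0 -EFinB opprK addrC.
- by apply: continuous_subspaceT => t; apply: continuous_comp; [exact: cs|exact: cf].
- have cG : continuous (fun t => - F (s - t)).
    move=> t; apply/differentiable_continuous/derivable1_diffP.
    exact: (@ex_derive _ _ _ _ _ _ _ (dG t)).
  split.
  + by move=> t _; exact: (@ex_derive _ _ _ _ _ _ _ (dG t)).
  + exact/cvg_at_right_filter/cG.
  + exact/cvg_at_left_filter/cG.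
- by move=> t _; rewrite derive1E; exact: (@derive_val _ _ _ _ _ _ _ (dG t)).
Qed.

(** [exp (-1/x)] for positive [x]: it vanishes on the left of 0 and tends to 1 at
   infinity, so that [theta (k x)] approaches the indicator of the positive axis. *)
Let theta := flat (1 : {poly R}).

Let thetaE x : 0 < x -> theta x = expR (- x^-1).
Proof. by move=> x0; rewrite /theta /flat x0 hornerE mul1r. Qed.

Let theta_le0 x : x <= 0 -> theta x = 0.
Proof. by rewrite leNgt /theta /flat => /negbTE ->. Qed.

Let theta01 x : 0 <= theta x <= 1.
Proof.
have [x0|x0] := leP x 0; first by rewrite theta_le0// lexx ler01.
by rewrite thetaE// expR_ge0 -expR0 ler_expR oppr_le0 invr_ge0 ltW.
Qed.

Let theta_near1 x : 0 < x -> 1 - theta x <= x^-1.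
Proof.
move=> x0; rewrite thetaE// lerBlDr -lerBlDl.
exact: expR_ge1Dx.
Qed.

(** The right end of the bumps lies beyond [b], by at most [eta], and tends to it: the
    limit is then 1 at [b], as for the half-open boxes used throughout. *)
Lemma smooth_bump a b eta : 0 < eta -> exists f : nat -> R -> R,
  [/\ forall k, smooth1 (f k),
      forall k x, 0 <= f k x <= 1,
      forall k x, x <= a -> f k x = 0,
      forall k x, b + eta <= x -> f k x = 0 &
      forall x, f k x @[k --> \oo] --> (if a < x <= b then 1 else 0 : R)].
Proof.
move=> eta0.
(* the left factor switches on at [a], with slope [k + 1]; the right one, with
   slope [(k + 1) ^ 2], switches off at [b + eta / (k + 1)], which is to the right
   of [b] but tends to it; at [b] its argument is still [(k + 1) eta] *)
pose f k x := theta (k.+1%:R * x + - (k.+1%:R * a)) *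
  theta (- k.+1%:R ^+ 2 * x + (k.+1%:R ^+ 2 * b + k.+1%:R * eta)).
have k0 k : 0 < k.+1%:R :> R by rewrite ltr0n.
have k1 k : 1 <= k.+1%:R :> R by rewrite ler1n.
have fr k x : b + k.+1%:R^-1 * eta <= x -> f k x = 0.
  move=> bx; rewrite /f [X in _ * X]theta_le0 ?mulr0//.
  rewrite addrC mulNr subr_le0 expr2 -!mulrA -mulrDr ler_pM2l//.
  rewrite (le_trans _ (ler_wpM2l (ltW (k0 k)) bx))//.
  by rewrite mulrDr mulVKf ?gt_eqF.
exists f; split.
- move=> k; apply: smooth1M; apply: smooth1_affine; exact: smooth1_flat.
- move=> k x; rewrite /f; set u := theta _; set v := theta _.
  have /andP[u0 u1] : 0 <= u <= 1 by exact: theta01.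
  have /andP[v0 v1] : 0 <= v <= 1 by exact: theta01.
  by rewrite mulr_ge0// mulr_ile1.
- move=> k x xa; rewrite /f theta_le0 ?mul0r//.
  by rewrite -mulrBr mulr_ge0_le0 ?subr_le0// ltW.
- move=> k x bx; apply: fr; rewrite (le_trans _ bx)// lerD2l.
  by rewrite ler_piMl ?(ltW eta0)// invf_le1.
- move=> x; case: ifPn => [/andP[ax xb]|].
    have xa : 0 < x - a by rewrite subr_gt0.
    apply: (@squeeze_cvgr _ _ _ _
      (fun k => 1 - ((x - a)^-1 + eta^-1) * k.+1%:R^-1) (fun=> 1)).
    + near=> k; rewrite /f.
      have p1 : 0 < k.+1%:R * x + - (k.+1%:R * a).
        by rewrite -mulrBr mulr_gt0.
      have p2' : k.+1%:R * eta <=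
          - k.+1%:R ^+ 2 * x + (k.+1%:R ^+ 2 * b + k.+1%:R * eta).
        by rewrite addrA lerDr mulNr addrC -mulrBr mulr_ge0 ?subr_ge0// exprn_ge0.
      have p2 := lt_le_trans (mulr_gt0 (k0 k) eta0) p2'.
      have q1 := theta_near1 p1.
      have q2 := le_trans (theta_near1 p2) (_ : _ <= (k.+1%:R * eta)^-1).
      have {}q2 := q2 ltac:(by rewrite lef_pV2// posrE// mulr_gt0).
      rewrite -mulrBr invfM in q1; rewrite invfM in q2.
      move: q1 q2 (theta01 (k.+1%:R * x + - (k.+1%:R * a)))
        (theta01 (- k.+1%:R ^+ 2 * x + (k.+1%:R ^+ 2 * b + k.+1%:R * eta))).
      rewrite -mulrBr.
      set u := theta _; set v := theta _ => q1 q2 /andP[u0 u1] /andP[v0 v1].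
      rewrite mulr_ile1// andbT mulrDl.
      have uv : (1 - u) * (1 - v) >= 0 by rewrite mulr_ge0// subr_ge0.
      have -> : (x - a)^-1 / k.+1%:R + eta^-1 / k.+1%:R =
        k.+1%:R^-1 / (x - a) + k.+1%:R^-1 / eta by ring.
      move: q1 q2; set c1 := _ / (x - a); set c2 := _ / eta => q1 q2.
      by lra.
    + rewrite -[X in _ --> X]subr0; apply: cvgB; first exact: cvg_cst.
      rewrite -(mulr0 ((x - a)^-1 + eta^-1)); apply: cvgM; first exact: cvg_cst.
      exact: cvg_harmonic.
    + exact: cvg_cst.
  rewrite negb_and -leNgt -ltNge => /orP[xa|bx].
    rewrite (_ : (fun k => f k x) = fun=> 0); first exact: cvg_cst.
    apply/funext => k; rewrite /f theta_le0 ?mul0r//.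
    by rewrite -mulrBr mulr_ge0_le0 ?subr_le0// ltW.
  have q : 0 < (x - b) / eta by rewrite divr_gt0// subr_gt0.
  apply: cvg_near_cst; near=> k; apply: fr.
  rewrite -lerBrDl -ler_pdivlMr//.
  by apply: ltW; near: k; exact: (near_infty_natSinv_lt (PosNum q)).
Unshelve. all: by end_near. Qed.

End bump1.

(** * Tensor products of bumps as test functions *)

Section tensor.
Context {R : realType} {n : nat}.
Implicit Types (f g : 'I_n -> R -> R) (x : 'rV[R]_n) (i j : 'I_n) (a b : 'rV[R]_n).

(** Products of functions of one coordinate: partial derivatives stay in this class,
    so that smoothness reduces to one variable. *)
Definition tensor f x : R := \prod_i f i (x ord0 i).

Definition fupdate f i (h : R -> R) j := if j == i then h else f j.

Lemma tensorD1 f i x :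
  tensor f x = f i (x ord0 i) * \prod_(j | j != i) f j (x ord0 j).
Proof. by rewrite /tensor (bigD1 i). Qed.

Lemma tensor_fupdate f i h x :
  tensor (fupdate f i h) x = h (x ord0 i) * \prod_(j | j != i) f j (x ord0 j).
Proof.
rewrite (tensorD1 _ i) /fupdate eqxx; congr (_ * _).
by apply: eq_bigr => j /negbTE ->.
Qed.

(** Along the [i]-th axis only the [i]-th factor varies. *)
Lemma is_derive_tensor f i (df : R -> R) x : (forall t : R, is_derive t (1 : R) (f i) (df t)) ->
  is_derive x (delta_mx ord0 i) (tensor f) (tensor (fupdate f i df) x).
Proof.
move=> fdf; set c := \prod_(j | j != i) f j (x ord0 j).
have qE : (fun h : R => h^-1 *: ((tensor f \o shift x) (h *: delta_mx ord0 i) - tensor f x)) =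
    (fun h : R => h^-1 *: ((f i \o shift (x ord0 i)) (h *: 1) - f i (x ord0 i)) * c).
  apply/funext => h /=; rewrite !(tensorD1 f i) !mxE !eqxx -/c.
  rewrite (eq_bigr (fun j => f j (x ord0 j))); last first.
    by move=> j ji; rewrite !mxE (negbTE ji) andbF mulr0 add0r.
  by rewrite -mulrBl -scalerAl.
have cv : h^-1 *: ((f i \o shift (x ord0 i)) (h *: 1) - f i (x ord0 i)) * c
    @[h --> 0^'] --> tensor (fupdate f i df) x.
  rewrite tensor_fupdate; apply: cvgM; last exact: cvg_cst.
  have := @ex_derive _ _ _ _ _ _ _ (fdf (x ord0 i)).
  move=> /cvg_toP; apply.
  exact: (@derive_val _ _ _ _ _ _ _ (fdf (x ord0 i))).
apply: DeriveDef; rewrite /derivable /derive qE.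
  by apply/cvg_ex; exists (tensor (fupdate f i df) x).
exact: cvg_lim cv.
Qed.

Lemma partial_tensor f i (df : R -> R) : (forall t : R, is_derive t (1 : R) (f i) (df t)) ->
  partial i (tensor f) = tensor (fupdate f i df).
Proof.
move=> fdf; apply/funext => x.
exact: (@derive_val _ _ _ _ _ _ _ (is_derive_tensor x fdf)).
Qed.

Lemma continuous_tensor f : (forall i, continuous (f i)) -> continuous (tensor f).
Proof.
move=> cf; apply: (@continuous_big R 'I_n *%R 1 xpredT (@mul_continuous R)
  'rV[R]_n (index_enum _) (fun i x => f i (x ord0 i))) => i _.
move=> x; apply: (@continuous_comp _ _ _ (fun x : 'rV[R]_n => x ord0 i) (f i)).
  exact: coord_continuous.
exact: cf.
Qed.

Lemma smooth_tensor f : (forall i, smooth1 (f i)) -> smooth (tensor f).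
Proof.
move=> sf s.
have [g sg ->] : exists2 g, forall i, smooth1 (g i) &
    foldr partial (tensor f) s = tensor g.
  elim: s => [|i s [g sg /= ->]]; first by exists f.
  exists (fupdate g i (g i)^`()%classic).
    move=> j; rewrite /fupdate; case: eqP => // _; exact: smooth1_derive1.
  by apply: partial_tensor => t; exact: smooth1_is_derive.
split; first by apply: continuous_tensor => i; exact: smooth1_continuous.
move=> i x; have d := is_derive_tensor x (fun t => smooth1_is_derive t (sg i)).
exact: (@ex_derive _ _ _ _ _ _ _ d).
Qed.

Definition cbox a b : set 'rV[R]_n :=
  [set x | forall i, a ord0 i <= x ord0 i <= b ord0 i].

Lemma compact_cbox a b : compact (cbox a b).
Proof.
have -> : cbox a b = [set v | forall i, `[a ord0 i, b ord0 i]%classic (v ord0 i)].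
  by rewrite eqEsubset; split=> x h i; have := h i; rewrite /= in_itv.
apply: (@rV_compact R n (fun i => `[a ord0 i, b ord0 i]%classic)) => i.
exact: segment_compact.
Qed.

Lemma closed_cbox a b : closed (cbox a b).
Proof.
apply: compact_closed; last exact: compact_cbox.
exact: norm_hausdorff.
Qed.

Lemma test_function_tensor Omega f a b : (forall i, smooth1 (f i)) ->
  (forall i t, f i t != 0 -> a ord0 i <= t <= b ord0 i) ->
  cbox a b `<=` Omega -> test_function Omega (tensor f).
Proof.
move=> sf fab abO.
have sub : closure [set x | tensor f x != 0] `<=` cbox a b.
  rewrite [X in _ `<=` X](_ : _ = closure (cbox a b)); last first.
    by apply/closure_id; exact: closed_cbox.
  apply: closure_subset => x /= fx0 i; apply: fab.
  by move: fx0; rewrite (tensorD1 f i) mulf_eq0 negb_or => /andP[].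
split; first exact: smooth_tensor.
- apply: subclosed_compact sub; first exact: closed_closure.
  exact: compact_cbox.
- exact: subset_trans abO.
Qed.

Lemma measurable_tensor f : (forall i, measurable_fun setT (f i)) ->
  measurable_fun setT (tensor f).
Proof.
move=> mf; apply: measurable_prod => i _.
exact: (measurableT_comp (mf i) (measurable_coord i)).
Qed.

Lemma tensor01 f x : (forall i t, 0 <= f i t <= 1) -> 0 <= tensor f x <= 1.
Proof.
move=> f01; rewrite prodr_ge0 => [|i _]; last by case/andP: (f01 i (x ord0 i)).
by rewrite prodr_ile1.
Qed.

End tensor.

(** * Functions with equal integrals over boxes *)

Section box_integrals.
Context {R : realType} {n : nat}.
Implicit Types (a b : 'rV[R]_n) (A : set 'rV[R]_n) (f g : 'rV[R]_n -> \bar R).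

Section density.
Variable f : 'rV[R]_n -> \bar R.
Hypothesis mf : measurable_fun setT f.
Hypothesis f0 : forall x, (0 <= f x)%E.

Definition density A : \bar R := (\int[leb n]_(x in A) f x)%E.

Let density0 : density set0 = 0%E.
Proof. exact: integral_set0. Qed.

Let density_ge0 A : (0 <= density A)%E.
Proof. exact: integral_ge0. Qed.

Let density_sigma_additive : semi_sigma_additive density.
Proof.
move=> F mF tF mUF; rewrite /density ge0_integral_bigcup//; last first.
  exact: measurable_funTS.
by apply: is_cvg_ereal_nneg_natsum_cond => k _ _; exact: integral_ge0.
Qed.

HB.instance Definition _ := isMeasure.Build _ _ _ density
  density0 density_ge0 density_sigma_additive.

Definition density_measure : {measure set 'rV[R]_n -> \bar R} := density.

End density.

Lemma ge0_integral_eq_rbox f g : measurable_fun setT f -> measurable_fun setT g ->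
  (forall x, (0 <= f x)%E) -> (forall x, (0 <= g x)%E) ->
  (forall a b, (\int[leb n]_(x in rbox a b) f x = \int[leb n]_(x in rbox a b) g x)%E) ->
  (\int[leb n]_x f x < +oo)%E ->
  forall A, measurable A -> (\int[leb n]_(x in A) f x = \int[leb n]_(x in A) g x)%E.
Proof.
move=> mf mg f0 g0 fg foo A mA.
apply: (@measure_eq_rbox _ _ (density_measure mf f0) (density_measure mg g0)) => //.
move=> a b; apply: le_lt_trans foo.
by apply: ge0_subset_integral => //; exact: measurable_rbox.
Qed.

(** An integrable function is determined, up to a null set, by its integrals over
    boxes. *)
Lemma ae_eq_of_rbox f g : (leb n).-integrable setT f -> (leb n).-integrable setT g ->
  (forall a b, (\int[leb n]_(x in rbox a b) f x = \int[leb n]_(x in rbox a b) g x)%E) ->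
  ae_eq (leb n) setT f g.
Proof.
move=> intf intg fg.
have mf := measurable_int _ intf; have mg := measurable_int _ intg.
have restr h A : (leb n).-integrable setT h -> measurable A ->
    (leb n).-integrable A h.
  by move=> inth mA; apply: integrableS inth.
have fin h A : (leb n).-integrable setT h -> measurable A ->
    ((\int[leb n]_(x in A) h^\+ x)%E \is a fin_num) *
    ((\int[leb n]_(x in A) h^\- x)%E \is a fin_num).
  move=> inth mA; split; apply: integrable_fin_num => //.
    exact/integrable_funepos/restr.
  exact/integrable_funeneg/restr.
(* moving the negative parts to the other side leaves nonnegative densities *)
have key A : measurable A ->
    (\int[leb n]_(x in A) f x = \int[leb n]_(x in A) g x <->
     \int[leb n]_(x in A) (f^\+ x + g^\- x) = \int[leb n]_(x in A) (g^\+ x + f^\- x))%E.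
  move=> mA; rewrite !ge0_integralD//; try by apply: measurable_funTS;
    (exact: measurable_funepos || exact: measurable_funeneg).
  rewrite (integralE _ _ f) (integralE _ _ g).
  have [/fineK <- /fineK <-] := fin _ _ intf mA.
  have [/fineK <- /fineK <-] := fin _ _ intg mA.
  rewrite -!EFinB -!EFinD; split=> -[?]; congr EFin; lra.
apply: integral_ae_eq => // A _ mA; apply/(key _ mA).
apply: ge0_integral_eq_rbox => //.
- by apply: emeasurable_funD; [exact: measurable_funepos|exact: measurable_funeneg].
- by apply: emeasurable_funD; [exact: measurable_funepos|exact: measurable_funeneg].
- by move=> x; exact: adde_ge0.
- by move=> x; exact: adde_ge0.
- by move=> a b; apply/key => //; exact: measurable_rbox.
- rewrite ge0_integralD//; [|exact: measurable_funepos|exact: measurable_funeneg].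
  have [/fineK <- _] := fin _ _ intf measurableT.
  have [_ /fineK <-] := fin _ _ intg measurableT.
  by rewrite -EFinD ltry.
Qed.

End box_integrals.

(** * Integration along a line *)

Section line_integral.
Context {R : realType} {n : nat}.
Implicit Types (z : 'rV[R]_n) (h : R).
Notation mu := (@lebesgue_measure R).
Notation leb := (@leb R n).

Let T2 := ('rV[R]_n * measurableTypeR R)%type.

Lemma measurable_along z d (U : measurableType d) (F : 'rV[R]_n -> U) :
  measurable_fun setT F -> measurable_fun setT (fun w : T2 => F (w.1 + w.2 *: z)).
Proof. by move=> mF; exact: (measurableT_comp mF (measurable_shift_line z)). Qed.

Lemma measurable_along_backward z d (U : measurableType d) (F : 'rV[R]_n -> U) :
  measurable_fun setT F -> measurable_fun setT (fun w : T2 => F (w.1 - w.2 *: z)).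
Proof.
move=> mF; under eq_fun do rewrite -scalerN.
exact: measurable_along.
Qed.

(** The indicator in the time variable replaces the integral over [0, h] by one over
   the whole line, as the product measure requires. *)
Lemma measurable_time h :
  measurable_fun setT (fun w : T2 => \1_(`[0, h] : set R) w.2 : R).
Proof.
have m1 : measurable_fun setT (\1_(`[0, h]%classic) : measurableTypeR R -> R).
  exact: measurable_indic.
exact: (measurableT_comp m1 measurable_snd).
Qed.

Lemma integral_time h (f : R -> R) :
  (\int[mu]_t (f t * \1_(`[0%R, h]) t)%:E = \int[mu]_(t in `[0%R, h]) (f t)%:E)%E.
Proof.
rewrite [RHS]integral_mkcond; apply: eq_integral => t _.
rewrite patchE indicE; case: ifPn => _; first by rewrite mulr1.
by rewrite mulr0.
Qed.

Lemma lebesgue_itv0 h : 0 <= h -> mu `[0, h] = h%:E.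
Proof.
move=> h0; rewrite lebesgue_measure_itv /= lte_fin.
by case: ltgtP h0 => // [_|<-]; rewrite ?subr0 ?oppr0 ?adde0.
Qed.

(** Integrating over [x] first, each translate of [F] contributes the same integral. *)
Lemma tonelli_line z h (F : 'rV[R]_n -> \bar R) : 0 <= h ->
  measurable_fun setT F -> (forall x, (0 <= F x)%E) ->
  (\int[leb]_x \int[mu]_(t in `[0%R, h]) F (x + t *: z)%R = h%:E * \int[leb]_x F x)%E.
Proof.
move=> h0 mF F0.
pose K (w : T2) := (F (w.1 + w.2 *: z)%R * (\1_(`[0, h] : set R) w.2)%:E)%E.
have mK : measurable_fun setT K.
  apply: emeasurable_funM; first exact: measurable_along.
  by apply/measurable_EFinP; exact: measurable_time.
have K0 w : (0 <= K w)%E by rewrite /K mule_ge0// lee_fin indicE.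
transitivity (\int[leb]_x \int[mu]_t K (x, t))%E.
  apply: eq_integral => x _; rewrite [LHS]integral_mkcond.
  apply: eq_integral => t _; rewrite patchE /K /= indicE.
  by case: ifPn => _; rewrite ?mule1 ?mule0.
rewrite (@fubini_tonelli _ _ _ _ R (@sleb R n) mu K mK K0).
transitivity (\int[mu]_t ((\1_(`[0, h] : set R) t)%:E * \int[leb]_x F x))%E.
  apply: eq_integral => t _; rewrite /K /=.
  under eq_integral do rewrite muleC.
  rewrite ge0_integralZl//; last first.
    exact: (measurableT_comp mF (measurable_shift (t *: z))).
  congr (_ * _)%E.
  by have := ge0_integral_shift (t *: z) measurableT mF (fun x _ => F0 x);
    rewrite preimage_setT.
rewrite ge0_integralZr//; last 2 first.
- by apply/measurable_EFinP; exact: measurable_indic.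
- exact: integral_ge0.
congr (_ * _)%E; rewrite integral_indic// setIT.
exact: lebesgue_itv0.
Qed.

Definition line_product : {measure set T2 -> \bar R} :=
  [the {measure set _ -> \bar R} of (@sleb R n \x mu)%E].

Lemma integrable_line z h (g : 'rV[R]_n -> R) : 0 <= h ->
  leb.-integrable setT (EFin \o g) ->
  line_product.-integrable setT
    (fun w : T2 => (`|g (w.1 + w.2 *: z)| * \1_(`[0, h] : set R) w.2)%:E).
Proof.
move=> h0 intg; have mg : measurable_fun setT g.
  by apply/measurable_EFinP; exact: measurable_int intg.
have mL : measurable_fun setT
    (fun w : T2 => (`|g (w.1 + w.2 *: z)| * \1_(`[0, h] : set R) w.2)%:E).
  apply/measurable_EFinP; apply: measurable_funM; last exact: measurable_time.
  apply: (measurable_along z (F := fun x => `|g x|)).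
  exact: measurableT_comp.
apply/(@integrable12ltyP _ _ _ _ R (@sleb R n) mu _ mL).
under eq_integral => x _.
  under eq_integral => t _.
    rewrite gee0_abs; last by rewrite lee_fin mulr_ge0// indicE.
    over.
  rewrite (integral_time h (fun t => `|g (x + t *: z)|)).
  over.
rewrite (tonelli_line z h0 (F := fun x => `|g x|%:E)) => [|| x]; last 2 first.
- by apply/measurable_EFinP; exact: measurableT_comp.
- by rewrite lee_fin.
case/integrableP : intg => _ /= goo.
rewrite lte_mul_pinfty//.
Qed.

Section swap.
Variables (z : 'rV[R]_n) (h : R) (g phi : 'rV[R]_n -> R).
Hypothesis h0 : 0 <= h.
Hypothesis intg : leb.-integrable setT (EFin \o g).
Hypothesis mphi : measurable_fun setT phi.
Hypothesis phi1 : forall x, `|phi x| <= 1.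

Let mg : measurable_fun setT g.
Proof. by apply/measurable_EFinP; exact: measurable_int intg. Qed.

Lemma integrable_line_weight : line_product.-integrable setT
  (fun w : T2 => (g (w.1 + w.2 *: z) * phi w.1 * \1_(`[0, h] : set R) w.2)%:E).
Proof.
apply: le_integrable (integrable_line z h0 intg) => //.
  apply/measurable_EFinP; apply: measurable_funM; last exact: measurable_time.
  apply: measurable_funM; first exact: (measurable_along z mg).
  exact: (measurableT_comp mphi measurable_fst).
move=> w _; rewrite lee_fin !normrM normr_id ler_wpM2r//.
by rewrite ler_piMr.
Qed.

Let integrable_line_weight' : line_product.-integrable setT
  (fun w : T2 => (g w.1 * phi (w.1 - w.2 *: z) * \1_(`[0, h] : set R) w.2)%:E).
Proof.
apply: le_integrable (integrable_line 0 h0 intg) => //.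
  apply/measurable_EFinP; apply: measurable_funM; last exact: measurable_time.
  apply: measurable_funM; first exact: (measurableT_comp mg measurable_fst).
  exact: measurable_along_backward.
move=> w _; rewrite lee_fin !normrM normr_id ler_wpM2r//.
by rewrite scaler0 addr0 ler_piMr.
Qed.

(** Moving the translation from the test function [phi] to [g]. *)
Lemma fubini_line :
  (\int[leb]_x \int[mu]_t (g x * phi (x - t *: z) * \1_(`[0%R, h] : set R) t)%:E =
   \int[line_product]_w
     (g (w.1 + w.2 *: z)%R * phi w.1 * \1_(`[0%R, h] : set R) w.2)%:E)%E.
Proof.
rewrite (@Fubini _ _ _ _ R (@sleb R n) mu _ integrable_line_weight').
rewrite -(@integral21_prod_meas1 _ _ _ _ R (@sleb R n) mu _ integrable_line_weight).
apply: eq_integral => t _; rewrite /fubini_G /=.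
pose f x := (g x * phi (x - t *: z) * \1_(`[0%R, h] : set R) t)%:E.
have intf : leb.-integrable setT f.
  apply: le_integrable intg => //.
    apply/measurable_EFinP; apply: measurable_funM => //.
    apply: measurable_funM => //.
    exact: (measurableT_comp mphi (measurable_shift (- (t *: z)))).
  move=> x _; rewrite lee_fin !normrM -mulrA ler_piMr// mulr_ile1//.
  by rewrite indicE; case: (_ \in _); rewrite ?normr1 ?normr0.
have := integral_shift (t *: z) measurableT intf.
rewrite preimage_setT => <-; apply: eq_integral => x _.
by rewrite /f addrK.
Qed.

End swap.

End line_integral.

(** * Differences of a weakly differentiable function *)

Section weak_difference.
Context {R : realType} {n : nat}.
Notation mu := (@lebesgue_measure R).
Notation leb := (@leb R n).

Lemma integrable_bounded_mul (v phi : 'rV[R]_n -> R) :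
  leb.-integrable setT (EFin \o v) -> measurable_fun setT phi ->
  (forall x, `|phi x| <= 1) ->
  leb.-integrable setT (fun x => (v x * phi x)%:E).
Proof.
move=> intv mphi phi1; have mv := measurable_int _ intv.
apply: le_integrable intv => //.
  by apply/measurable_EFinP; apply: measurable_funM => //; exact/measurable_EFinP.
by move=> x _; rewrite lee_fin normrM ler_piMr.
Qed.

Lemma integrable_difference (v : 'rV[R]_n -> R) (z : 'rV[R]_n) :
  leb.-integrable setT (EFin \o v) ->
  leb.-integrable setT (fun x => (v (x + z) - v x)%:E).
Proof.
move=> intv; under eq_fun do rewrite EFinB.
apply: integrableB => //.
by have := integrable_shift z measurableT intv; rewrite preimage_setT.
Qed.

Variables (Omega : set 'rV[R]_n) (v g : 'rV[R]_n -> R) (i : 'I_n).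
Hypothesis intv : leb.-integrable setT (EFin \o v).
Hypothesis intg : leb.-integrable setT (EFin \o g).
Hypothesis weak : forall phi, test_function Omega phi ->
  (\int[leb]_x (v x * partial i phi x)%:E = - \int[leb]_x (g x * phi x)%:E)%E.

Let e : 'rV[R]_n := delta_mx ord0 i.

Let tensor_shift (f : 'I_n -> R -> R) (t : R) (x : 'rV[R]_n) :
  tensor f (x - t *: e) = f i (x ord0 i - t) * \prod_(j | j != i) f j (x ord0 j).
Proof.
rewrite (tensorD1 f i) !mxE !eqxx mulr1; congr (_ * _).
by apply: eq_bigr => j ji; rewrite !mxE (negbTE ji) andbF mulr0 subr0.
Qed.

(** Test against [psi x = \int_0^h phi (x - t e) dt], where [phi] is the tensor
    product: the derivative of [psi] along [e] is [phi x - phi (x - h e)]. Since only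
    the [i]-th factor of [phi] moves, [psi] is again a tensor product. *)
Lemma weak_difference_tensor (f : 'I_n -> R -> R)
    (a b : 'rV[R]_n) (h : R) : 0 < h ->
  (forall j, smooth1 (f j)) -> (forall j t, 0 <= f j t <= 1) ->
  (forall j t, t <= a ord0 j -> f j t = 0) ->
  (forall j t, b ord0 j <= t -> f j t = 0) ->
  cbox a (b + h *: e) `<=` Omega ->
  (\int[leb]_x ((v (x + h *: e) - v x) * tensor f x)%R%:E =
   \int[@line_product R n]_w
     (g (w.1 + w.2 *: e) * tensor f w.1 * \1_(`[0%R, h]) w.2)%R%:E)%E.
Proof.
move=> h0 sf f01 fa fb abO; have ci j := smooth1_continuous (sf j).
have [F [dF F0]] := exists_antiderivative (ci i) (fa i).
pose Psi s := F s - F (s - h).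
have PsiE s : (Psi s)%:E = (\int[mu]_(t in `[0%R, h]) (f i (s - t)%R)%:E)%E.
  by rewrite (integral_window s h0 (ci i) dF).
have dPsi s : is_derive s (1 : R) Psi (f i s - f i (s - h)).
  have d1 : is_derive s (1 : R) (fun s => F (s - h)) (f i (s - h)).
    have da := is_derive_affine 1 (- h) s.
    have := @is_derive1_comp _ F (fun s => 1 * s + - h) s _ _ (dF _) da.
    rewrite mulr1 mul1r; congr (is_derive _ _ _ _).
    by apply/funext => r /=; rewrite mul1r.
  exact: is_deriveB (dF s) d1.
have sdPsi : smooth1 (fun s => f i s - f i (s - h)).
  apply: (smooth1D (sf i)).
  apply: (smooth1N (f := fun s => f i (s - h))).
  have := smooth1_affine 1 (- h) (sf i); congr (smooth1 _).
  by apply/funext => r /=; rewrite mul1r.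
have sPsi : smooth1 Psi by exact: smooth1_antiderivative sdPsi.
pose c (x : 'rV[R]_n) := \prod_(j | j != i) f j (x ord0 j).
pose psi := tensor (fupdate f i Psi).
have tpsi : test_function Omega psi.
  apply: test_function_tensor abO.
    by move=> j; rewrite /fupdate; case: eqP.
  move=> j t; rewrite /fupdate !mxE eqxx /=.
  case: (j =P i) => [->|_]; last first.
    rewrite mulr0 addr0; apply: contraNT; rewrite negb_and -!ltNge => /orP[ta|bt].
      by rewrite fa// ltW.
    by rewrite fb// ltW.
  rewrite mulr1; apply: contraNT; rewrite negb_and -!ltNge => /orP[ta|bt].
    rewrite /Psi F0 ?(ltW ta)// F0 ?subrr//.
    by rewrite lerBlDr (le_trans (ltW ta))// lerDl ltW.
  apply/eqP/EFin_inj; rewrite PsiE integral0_eq// => r; rewrite /= in_itv /= => /andP[_ rh].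
  by rewrite fb// lerBrDr (le_trans _ (ltW bt))// lerD2l.
have mphi : measurable_fun setT (tensor f).
  apply: measurable_tensor => j; exact: continuous_measurable_fun.
have phi1 x : `|tensor f x| <= 1.
  by have /andP[p0 p1] := tensor01 x f01; rewrite ger0_norm.
rewrite -(fubini_line e (ltW h0) intg mphi phi1).
transitivity (\int[leb]_x (g x * psi x)%:E)%E; last first.
  apply: eq_integral => x _.
  transitivity (\int[mu]_t ((g x * c x * f i (x ord0 i - t)) * \1_(`[0%R, h]) t)%:E)%E;
    last first.
    apply: eq_integral => t _; rewrite tensor_shift; congr EFin.
    by rewrite -/(c x); ring.
  rewrite integral_time; under eq_integral => t _ do rewrite EFinM.
  have cw : continuous (fun t => f i (x ord0 i - t)).
    move=> t; apply: continuous_comp; last exact: ci.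
    by apply: cvgB; [exact: cvg_cst|exact: cvg_id].
  rewrite integralZl//; last exact: (continuous_itv_integrable 0 h cw).
  by rewrite -PsiE -EFinM /psi tensor_fupdate -/(c x) mulrAC mulrA.
have mphih : measurable_fun setT (fun x : 'rV[R]_n => tensor f (x - h *: e)).
  exact: (measurableT_comp mphi (measurable_shift (- (h *: e)))).
have intvphi := integrable_bounded_mul intv mphi phi1.
have intvphih : leb.-integrable setT (fun x : 'rV[R]_n => (v x * tensor f (x - h *: e))%:E).
  by apply: integrable_bounded_mul => // x; exact: phi1.
have partialE x : partial i psi x = tensor f x - tensor f (x - h *: e).
  have d2 (t : R) : is_derive t (1 : R) (fupdate f i Psi i) (f i t - f i (t - h)).
    by rewrite /fupdate eqxx.
  rewrite (partial_tensor d2).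
  rewrite tensor_shift (tensorD1 f i) tensor_fupdate -mulrBl; congr (_ * _).
  by apply: eq_bigr => j /negbTE ji; rewrite /fupdate ji.
have /esym/eqP := weak tpsi; rewrite eqe_oppLR => /eqP ->.
under [in RHS]eq_integral => x _ do rewrite partialE mulrBr EFinB.
rewrite integralB_EFin//.
under [in LHS]eq_integral => x _ do rewrite mulrBl EFinB.
have intvh : leb.-integrable setT (fun x : 'rV[R]_n => (v (x + h *: e) * tensor f x)%:E).
  have := integrable_shift (h *: e) measurableT intvphih.
  by rewrite preimage_setT; under eq_fun do rewrite addrK.
have shiftE : (\int[leb]_x (v (x + h *: e) * tensor f x)%R%:E =
    \int[leb]_x (v x * tensor f (x - h *: e))%R%:E)%E.
  rewrite -(integral_shift (h *: e) measurableT intvphih) preimage_setT.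
  by apply: eq_integral => x _; rewrite addrK.
rewrite integralB_EFin// shiftE oppeB//.
  by rewrite addeC.
by apply: fin_num_adde_defr; apply: integrable_fin_num.
Qed.

End weak_difference.

Section weak_difference_box.
Context {R : realType} {n : nat}.
Notation mu := (@lebesgue_measure R).
Notation leb := (@leb R n).
Variables (Omega : set 'rV[R]_n) (v g : 'rV[R]_n -> R) (i : 'I_n).
Hypothesis intv : leb.-integrable setT (EFin \o v).
Hypothesis intg : leb.-integrable setT (EFin \o g).
Hypothesis weak : forall phi, test_function Omega phi ->
  (\int[leb]_x (v x * partial i phi x)%:E = - \int[leb]_x (g x * phi x)%:E)%E.

Let e : 'rV[R]_n := delta_mx ord0 i.

Let indic_tensor (a b : 'rV[R]_n) x : \1_(rbox a b) x =
  \prod_j (if a ord0 j < x ord0 j <= b ord0 j then 1 else 0) :> R.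
Proof.
rewrite indicE; case: (boolP (x \in _)) => [|] xab.
  by rewrite big1// => j _; move: xab; rewrite inE => /(_ j) ->.
apply/esym/eqP; rewrite prodf_seq_eq0; apply/hasP.
move: xab; rewrite notin_setE => /existsNP[j /negP xj].
by exists j; rewrite ?mem_index_enum// (negbTE xj) eqxx.
Qed.

Let integral_indicr (f : 'rV[R]_n -> R) D : 
  (\int[leb]_x (f x * \1_D x)%:E = \int[leb]_(x in D) (f x)%:E)%E.
Proof.
rewrite [RHS]integral_mkcond; apply: eq_integral => x _.
by rewrite patchE indicE; case: ifPn => _; rewrite ?mulr1 ?mulr0.
Qed.

(** Smooth tensor products approach the indicator of the box boundedly, so that the
    identity for test functions passes to the limit. The margin [eta] leaves room for
    their supports. *)
Lemma weak_difference_box a b (h eta : R) : 0 < h -> 0 < eta ->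
  cbox a (b + const_mx eta + h *: e) `<=` Omega ->
  (\int[leb]_(x in rbox a b) (v (x + h *: e) - v x)%R%:E =
   \int[leb]_(x in rbox a b) \int[mu]_(t in `[0%R, h]) (g (x + t *: e)%R)%:E)%E.
Proof.
move=> h0 eta0 abO.
have [f fP] := choice (fun j => smooth_bump (a ord0 j) (b ord0 j) eta0).
pose phi k := tensor (fun j => f j k).
have phi01 k x : 0 <= phi k x <= 1.
  by apply: tensor01 => j t; have [_ H _ _ _] := fP j; exact: H.
have phi1 k x : `|phi k x| <= 1.
  by have /andP[p0 p1] := phi01 k x; rewrite ger0_norm.
have mphi k : measurable_fun setT (phi k).
  apply: measurable_tensor => j; apply: continuous_measurable_fun.
  by apply: smooth1_continuous; have [H _ _ _ _] := fP j; exact: H.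
have phil x : phi k x @[k --> \oo] --> (\1_(rbox a b) x : R).
  rewrite indic_tensor; apply: cvg_big => [|j _]; first exact: mul_continuous.
  by have [_ _ _ _ H] := fP j; exact: H.
pose dv x := v (x + h *: e) - v x.
have intdv : leb.-integrable setT (EFin \o dv) by exact: integrable_difference.
have mdv : measurable_fun setT dv by apply/measurable_EFinP; exact: measurable_int intdv.
have mD := measurable_rbox a b.
pose L k (w : 'rV[R]_n * measurableTypeR R) :=
  (g (w.1 + w.2 *: e) * phi k w.1 * \1_(`[0%R, h]) w.2)%:E.
pose L' (w : 'rV[R]_n * measurableTypeR R) :=
  (g (w.1 + w.2 *: e) * \1_(rbox a b) w.1 * \1_(`[0%R, h]) w.2)%:E.
have identity k : (\int[leb]_x (dv x * phi k x)%:E =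
    \int[@line_product R n]_w L k w)%E.
  apply: (weak_difference_tensor intv intg weak (a := a) (b := b + const_mx eta)) => //.
  - by move=> j; have [H _ _ _ _] := fP j; exact: H.
  - by move=> j t; have [_ H _ _ _] := fP j; exact: H.
  - by move=> j t; have [_ _ H _ _] := fP j; exact: H.
  - by move=> j t; have [_ _ _ H _] := fP j; rewrite !mxE; exact: H.
have indic1 (x : 'rV[R]_n) : `|\1_(rbox a b) x : R| <= 1.
  by rewrite indicE; case: (_ \in _); rewrite ?normr1 ?normr0.
have mindic : measurable_fun setT (\1_(rbox a b) : 'rV[R]_n -> R).
  exact: measurable_indic.
have intL' := integrable_line_weight e (ltW h0) intg mindic indic1.
have cv1 : (\int[leb]_x (dv x * phi k x)%:E)%E @[k --> \oo] -->
    (\int[leb]_x (dv x * \1_(rbox a b) x)%:E)%E.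
  have [] := @dominated_convergence _ _ R leb setT measurableT
    (fun k x => (dv x * phi k x)%:E) (fun x => (dv x * \1_(rbox a b) x)%:E)
    (fun x => `|dv x|%:E) => //.
  - by move=> k; apply/measurable_EFinP; exact: measurable_funM.
  - by apply/measurable_EFinP; exact: measurable_funM.
  - apply: aeW => x _; apply: cvg_EFin; first by near=> k.
    by apply: cvgM; [exact: cvg_cst|exact: phil].
  - by have := integrable_abse intdv.
  - by apply: aeW => x k _; rewrite lee_fin normrM ler_piMr.
have cv2 : (\int[@line_product R n]_w L k w)%E @[k --> \oo] -->
    (\int[@line_product R n]_w L' w)%E.
  have [] := @dominated_convergence _ _ R (@line_product R n) setT measurableT L L'
    (fun w => (`|g (w.1 + w.2 *: e)| * \1_(`[0, h] : set R) w.2)%:E) => //.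
  - move=> k; have := integrable_line_weight e (ltW h0) intg (mphi k) (phi1 k).
    by move=> /(measurable_int _).
  - by have := measurable_int _ intL'.
  - apply: aeW => w _; apply: cvg_EFin; first by near=> k.
    apply: cvgM; last exact: cvg_cst.
    by apply: cvgM; [exact: cvg_cst|exact: phil].
  - exact: integrable_line (ltW h0) intg.
  - apply: aeW => w k _; rewrite lee_fin !normrM ler_pM ?mulr_ge0//.
      by rewrite ler_piMr.
    by rewrite ger0_norm// indicE.
rewrite -integral_indicr.
transitivity (\int[@line_product R n]_w L' w)%E.
  rewrite (funext identity) in cv1.
  exact: (cvg_unique (@ereal_hausdorff R) cv1 cv2).
rewrite -(@integral12_prod_meas1 _ _ _ _ R (@sleb R n) mu _ intL').
rewrite [RHS]integral_mkcond; apply: eq_integral => x _.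
rewrite patchE /fubini_F /L' /= [\1_(rbox a b) x]indicE.
case: ifPn => _; last first.
  by apply: integral0_eq => t _; rewrite mulr0 mul0r.
rewrite -integral_time; apply: eq_integral => t _.
by rewrite mulr1.
Unshelve. all: by end_near. Qed.

(** The fundamental theorem of calculus holds a.e. for weak derivatives, because both
    sides have the same integral over every box contained in [rbox a b]. *)
Lemma ae_eq_weak_difference a b (h eta : R) : 0 < h -> 0 < eta ->
  cbox a (b + const_mx eta + h *: e) `<=` Omega ->
  ae_eq leb (rbox a b) (fun x => (v (x + h *: e) - v x)%:E)
    (fun x => \int[mu]_(t in `[0%R, h]) (g (x + t *: e)%R)%:E)%E.
Proof.
move=> h0 eta0 abO; have mD := measurable_rbox a b.
pose G x := (\int[mu]_(t in `[0%R, h]) (g (x + t *: e)%R)%:E)%E.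
have intG : leb.-integrable setT G.
  have intL := integrable_line_weight e (ltW h0) intg (measurable_cst (1 : R))
    (fun _ => eq_ind_r (fun r => is_true (r <= 1)) (lexx 1) (@normr1 R)).
  apply: eq_integrable (integrable_fubini_F intL) => // x _.
  by rewrite /fubini_F /= /G -integral_time; under eq_integral do rewrite mulr1.
have intdv := integrable_difference (h *: e) intv.
have restr (f : 'rV[R]_n -> \bar R) : leb.-integrable setT f ->
    leb.-integrable setT (f \_ (rbox a b)).
  move=> intf; apply: (iffLR (integrable_mkcond _ mD)).
  exact: (@integrableS _ _ _ leb setT).
have boxE c d :
    (\int[leb]_(x in rbox c d) ((fun x => (v (x + h *: e)%R - v x)%:E) \_ (rbox a b)) x =
    \int[leb]_(x in rbox c d) (G \_ (rbox a b)) x)%E.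
  rewrite -!integral_mkcondr rbox_setI.
  apply: (weak_difference_box h0 eta0); apply: subset_trans abO => x xcd j.
  have := xcd j; rewrite !mxE ge_max => /andP[/andP[_ ->] xd] /=.
  by rewrite (le_trans xd)// !lerD2r ge_min lexx orbT.
have : ae_eq leb setT ((fun x => (v (x + h *: e)%R - v x)%:E) \_ (rbox a b))
    (G \_ (rbox a b)) by apply: ae_eq_of_rbox boxE; exact: restr.
apply: filterS => x /(_ I) + abx.
by rewrite !patchE mem_set.
Qed.

End weak_difference_box.

(** * Elementary inequalities for powers *)

Section powers.
Context {R : realType}.
Implicit Types (p a b m : R).

Lemma powR_add_le p a b : 0 <= p ->
  `|a + b| `^ p <= 2 `^ p * (`|a| `^ p + `|b| `^ p).
Proof.
move=> p0; wlog ab : a b / `|b| <= `|a|.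
  move=> H; have [ab|/ltW ab] := leP `|b| `|a|; first exact: H.
  by rewrite addrC [X in _ * X]addrC; exact: H.
rewrite (le_trans (ge0_ler_powR p0 _ _ (_ : _ <= 2 * `|a|))) ?nnegrE ?mulr_ge0//.
  by rewrite (le_trans (ler_normD _ _))// mulr_natl mulr2n lerD2l.
by rewrite powRM// ler_wpM2l ?powR_ge0// lerDl powR_ge0.
Qed.

(** A crude form of Young's inequality: if [a <= m] the second term dominates, and if
    [m <= a] the first one does. *)
Lemma young_powR p a m : 1 < p -> 0 <= a -> 0 <= m ->
  m `^ (p - 1) * a <= a `^ p + m `^ p.
Proof.
move=> p1 a0 m0; have p0 : 0 < p by exact: lt_trans p1.
have q0 : 0 <= p - 1 by rewrite subr_ge0 ltW.
have [am|/ltW ma] := leP a m.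
  rewrite (le_trans (ler_wpM2l (powR_ge0 _ _) am))// mulrC mulr_powRB1//.
  by rewrite lerDr powR_ge0.
rewrite mulrC (le_trans (ler_wpM2l a0 (ge0_ler_powR q0 _ _ ma))) ?nnegrE//.
by rewrite mulr_powRB1// lerDl powR_ge0.
Qed.

Lemma measurable_pow_norm d (T : measurableType d) (D : set T) (f : T -> R) p :
  measurable_fun D f -> measurable_fun D (fun x => `|f x| `^ p).
Proof.
move=> mf; apply: (measurableT_comp (measurable_powR p)).
exact: measurableT_comp.
Qed.

(** Jensen's inequality for [t ^ p] up to the factor [2 ^ p]. Integrating Young's
    inequality for [|f x|] and [m] gives [2 m ^ p c <= \int |f| ^ p + m ^ p c]. *)
Lemma weak_jensen d (T : measurableType d) (mu : {measure set T -> \bar R})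
    (D : set T) (f : T -> R) p m c : measurable D -> measurable_fun D f ->
  mu D = c%:E -> 1 < p -> 0 <= m ->
  ((2 * m * c)%:E <= \int[mu]_(x in D) `|f x|%:E)%E ->
  ((m `^ p * c)%:E <= \int[mu]_(x in D) (`|f x| `^ p)%:E)%E.
Proof.
move=> mD mf muD p1 m0 mean.
have mf1 : measurable_fun D (fun x => `|f x|%:E).
  by apply/measurable_EFinP; exact: measurableT_comp.
have mfp : measurable_fun D (fun x => (`|f x| `^ p)%:E).
  by apply/measurable_EFinP; exact: measurable_pow_norm.
have young : ((m `^ (p - 1))%:E * \int[mu]_(x in D) `|f x|%:E <=
    \int[mu]_(x in D) (`|f x| `^ p)%:E + (m `^ p * c)%:E)%E.
  rewrite -ge0_integralZl_EFin ?powR_ge0//.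
  have -> : (m `^ p * c)%:E = (\int[mu]_(x in D) (m `^ p)%:E)%E.
    by rewrite integral_cst// muD EFinM.
  rewrite -ge0_integralD//; last first.
    by move=> x _; rewrite lee_fin powR_ge0.
  apply: ge0_le_integral => //.
  - by move=> x _; rewrite -EFinM lee_fin mulr_ge0// powR_ge0.
  - by apply: emeasurable_funM => //; exact: measurable_cst.
  - by apply: emeasurable_funD => //; exact: measurable_cst.
  - by move=> x _; rewrite -EFinM -EFinD lee_fin young_powR.
have := le_trans (lee_wpmul2l (_ : 0 <= (m `^ (p - 1))%:E)%E mean) young.
rewrite lee_fin powR_ge0 => /(_ isT).
rewrite -EFinM (_ : m `^ (p - 1) * _ = 2 * (m `^ p * c)); last first.
  by rewrite -(mulr_powRB1 m0 (lt_trans ltr01 p1)); ring.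
case: (integral _ _ _) => [r| |].
- by rewrite -EFinD !lee_fin; lra.
- by move=> _; rewrite leey.
- by rewrite addNye leeNy_eq => /eqP.
Qed.

End powers.

(** * Translation estimates in L^p *)

Section translation_estimate.
Context {R : realType} {n : nat}.
Notation mu := (@lebesgue_measure R).
Notation leb := (@leb R n).
Variables (Omega : set 'rV[R]_n) (v : 'rV[R]_n -> R) (p : R).
Hypothesis p1 : 1 < p.
Hypothesis intv : leb.-integrable setT (EFin \o v).

Let p_gt0 : 0 < p. Proof. exact: lt_trans p1. Qed.
Let p_ge0 : 0 <= p. Proof. exact: ltW. Qed.

Let mv : measurable_fun setT v.
Proof. by apply/measurable_EFinP; exact: measurable_int intv. Qed.

Let mvz (z : 'rV[R]_n) : measurable_fun setT (fun x : 'rV[R]_n => v (x + z)).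
Proof. exact: (measurableT_comp mv (measurable_shift z)). Qed.

Let mdv (z w : 'rV[R]_n) : measurable_fun setT
  (fun x : 'rV[R]_n => (`|v (x + z) - v (x + w)| `^ p)%:E).
Proof.
apply/measurable_EFinP/measurable_pow_norm.
exact: (measurable_funB (mvz z) (mvz w)).
Qed.

Section one_direction.
Variables (g : 'rV[R]_n -> R) (i : 'I_n) (M : R).
Hypothesis intg : leb.-integrable setT (EFin \o g).
Hypothesis weak : forall phi, test_function Omega phi ->
  (\int[leb]_x (v x * partial i phi x)%:E = - \int[leb]_x (g x * phi x)%:E)%E.
Hypothesis gM : (\int[leb]_x (`|g x| `^ p)%:E <= M%:E)%E.

Let e : 'rV[R]_n := delta_mx ord0 i.

Let mg : measurable_fun setT g.
Proof. by apply/measurable_EFinP; exact: measurable_int intg. Qed.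

Let mgp : measurable_fun setT (fun x => (`|g x| `^ p)%:E).
Proof. by apply/measurable_EFinP; exact: measurable_pow_norm. Qed.

Let gp_ge0 x : (0 <= (`|g x| `^ p)%:E)%E.
Proof. by rewrite lee_fin powR_ge0. Qed.

(** By the a.e. formula and Jensen, [|v (x + h e) - v x| ^ p] is at most
    [(2 h) ^ p / h] times the integral of [|g (x + t e)| ^ p] over [0, h]; integrate
    over [x]. *)
Let translation_estimate_pos (a b : 'rV[R]_n) (h eta : R) : 0 < h -> 0 < eta ->
  cbox a (b + const_mx eta + h *: e) `<=` Omega ->
  (\int[leb]_(x in rbox a b) (`|v (x + h *: e) - v x| `^ p)%:E <=
    ((2 * h) `^ p * M)%:E)%E.
Proof.
move=> h0 eta0 abO; have mD := measurable_rbox a b.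
have aeG := ae_eq_weak_difference intv intg weak h0 eta0 abO.
pose H x := (\int[mu]_(t in `[0%R, h]) (`|g (x + t *: e)%R| `^ p)%:E)%E.
have mline x : measurable_fun setT (fun t : measurableTypeR R => g (x + t *: e)).
  apply: (measurableT_comp mg); apply: measurable_rV => j.
  under eq_fun do rewrite !mxE.
  by apply: measurable_funD => //; apply: measurable_funM => //; exact: measurable_id.
have mH : measurable_fun setT H.
  have mK : measurable_fun setT (fun w : 'rV[R]_n * measurableTypeR R =>
      ((`|g (w.1 + w.2 *: e)| `^ p) * \1_(`[0, h]) w.2)%:E).
    apply/measurable_EFinP; apply: measurable_funM; last exact: measurable_time.
    apply: (measurable_along e (F := fun x => `|g x| `^ p)).
    exact: measurable_pow_norm.
  have := @measurable_fun_fubini_tonelli_F _ _ _ _ R mu _ mK.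
  have -> : fubini_F mu (fun w : 'rV[R]_n * measurableTypeR R =>
      ((`|g (w.1 + w.2 *: e)| `^ p) * \1_(`[0, h]) w.2)%:E) = H.
    by apply/funext => x; rewrite /fubini_F /= integral_time.
  by apply => w; rewrite lee_fin mulr_ge0 ?powR_ge0// indicE.
have H0 x : (0 <= H x)%E.
  by apply: integral_ge0 => t _; rewrite lee_fin powR_ge0.
pose k := (2 * h) `^ p / h.
have k0 : 0 <= k by rewrite divr_ge0 ?powR_ge0// ltW.
have bound : (\int[leb]_(x in rbox a b) (`|v (x + h *: e) - v x| `^ p)%:E <=
    \int[leb]_(x in rbox a b) (k%:E * H x))%E.
  apply: ae_ge0_le_integral => //.
  - apply: measurable_funTS; have := mdv (h *: e) 0.
    by under eq_fun do rewrite addr0.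
  - by move=> x _; rewrite mule_ge0.
  - by apply: measurable_funTS; apply: emeasurable_funM.
  apply: filterS aeG => x + abx => /(_ abx) dvG.
  set y := `|v (x + h *: e) - v x|.
  have y0 : 0 <= y / (2 * h) by rewrite divr_ge0 ?mulr_ge0 ?(ltW h0) ?normr_ge0.
  have hJ : (((y / (2 * h)) `^ p * h)%:E <= H x)%E.
    apply: (@weak_jensen R _ (measurableTypeR R) mu `[0, h]%classic
      (fun t => g (x + t *: e))) => //.
    - exact: measurable_funTS.
    - exact: lebesgue_itv0 (ltW h0).
    have -> : 2 * (y / (2 * h)) * h = y by field; rewrite gt_eqF.
    have -> : y%:E = `|(v (x + h *: e) - v x)%:E|%E by [].
    rewrite dvG; apply: le_abse_integral => //.
    by apply/measurable_EFinP; exact: measurable_funTS.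
  apply: le_trans (lee_wpmul2l _ hJ); last by rewrite lee_fin.
  rewrite -EFinM lee_fin /k [(y / _) `^ _]powRM ?invr_ge0 ?mulr_ge0 ?(ltW h0)//.
  have h20 : 0 < 2 * h by rewrite mulr_gt0.
  have pV : (2 * h) `^ p * (2 * h)^-1 `^ p = 1.
    by rewrite -powRM ?invr_ge0 ?(ltW h20)// divff ?gt_eqF// powR1.
  have hV : h^-1 * h = 1 by rewrite mulVf// gt_eqF.
  have -> : (2 * h) `^ p / h * (y `^ p * (2 * h)^-1 `^ p * h) =
    y `^ p * ((2 * h) `^ p * (2 * h)^-1 `^ p) * (h^-1 * h) by ring.
    by rewrite pV hV !mulr1.
  exact: normr_ge0.
apply: (le_trans bound).
apply: (@le_trans _ _ (\int[leb]_x (k%:E * H x))%E).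
  apply: ge0_subset_integral => //; first exact: emeasurable_funM.
  by move=> x _; rewrite mule_ge0.
rewrite ge0_integralZl_EFin// (tonelli_line e (ltW h0) mgp gp_ge0) muleA -EFinM.
have -> : k * h = (2 * h) `^ p by rewrite /k divfK// gt_eqF.
by rewrite EFinM lee_wpmul2l// lee_fin powR_ge0.
Qed.

(** A negative [h] amounts to a positive one on the translated box. *)
Lemma translation_estimate_coord (a b : 'rV[R]_n) (h eta : R) : 0 < eta ->
  cbox (a + Num.min 0 h *: e) (b + const_mx eta + Num.max 0 h *: e) `<=` Omega ->
  (\int[leb]_(x in rbox a b) (`|v (x + h *: e) - v x| `^ p)%:E <=
    ((2 * `|h|) `^ p * M)%:E)%E.
Proof.
move=> eta0; have [h0|h0|->] := ltgtP h 0.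
- rewrite (ltr0_norm h0).
  have [k k0 ->] : exists2 k, 0 < k & h = - k.
    by exists (- h); rewrite ?oppr_gt0 ?opprK.
  rewrite scale0r addr0 scaleNr opprK => abO.
  have mD := measurable_rbox (a - k *: e) (b - k *: e).
  have := @ge0_integral_shift R n (- (k *: e)) _
    (fun y => (`|v (y + k *: e) - v y| `^ p)%:E) mD.
  rewrite preimage_shift_rbox opprK !subrK => H.
  have -> : (\int[leb]_(x in rbox a b) (`|v (x - k *: e)%R - v x| `^ p)%:E =
      \int[leb]_(x in rbox (a - k *: e)%R (b - k *: e)%R)
        (`|v (x + k *: e)%R - v x| `^ p)%:E)%E.
    rewrite -H; last 2 first.
    - apply: measurable_funTS; have := mdv (k *: e) 0.
      by under eq_fun do rewrite addr0.
    - by move=> x _; rewrite lee_fin powR_ge0.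
    by apply: eq_integral => x _; rewrite subrK distrC.
  apply: translation_estimate_pos (k0) (eta0) _.
  by rewrite addrAC subrK.
- rewrite (gtr0_norm h0) scale0r addr0 => abO.
  exact: translation_estimate_pos h0 eta0 abO.
- move=> _; under eq_integral => x _.
    rewrite scale0r addr0 subrr normr0 powR0 ?gt_eqF//; over.
  by rewrite integral0 normr0 mulr0 powR0 ?gt_eqF// mul0r.
Qed.

End one_direction.
End translation_estimate.

Section translation_cube.
Context {R : realType} {n : nat}.
Notation leb := (@leb R n).
Implicit Types (c x y z : 'rV[R]_n) (r s rho : R).

Definition qcube c r := rbox (c - const_mx r) (c + const_mx r).
Definition ccube c s := cbox (c - const_mx s) (c + const_mx s).

Lemma measurable_qcube c r : measurable (qcube c r).
Proof. exact: measurable_rbox. Qed.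

Lemma qcubeP c r x : (forall i, - r < x ord0 i - c ord0 i <= r) <-> qcube c r x.
Proof. by split=> h i; have := h i; rewrite !mxE; lra. Qed.

Variables (Omega : set 'rV[R]_n) (v : 'rV[R]_n -> R) (p : R).
Variables (g : 'I_n -> 'rV[R]_n -> R) (M : R).
Hypothesis p1 : 1 < p.
Hypothesis intv : leb.-integrable setT (EFin \o v).
Hypothesis intg : forall i, leb.-integrable setT (EFin \o g i).
Hypothesis weak : forall i phi, test_function Omega phi ->
  (\int[leb]_x (v x * partial i phi x)%:E = - \int[leb]_x (g i x * phi x)%:E)%E.
Hypothesis M0 : 0 <= M.
Hypothesis gM : forall i, (\int[leb]_x (`|g i x| `^ p)%:E <= M%:E)%E.

Let mv : measurable_fun setT v.
Proof. by apply/measurable_EFinP; exact: measurable_int intv. Qed.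

Lemma measurable_dv (D : set 'rV[R]_n) (z w : 'rV[R]_n) : measurable_fun D
  (fun x : 'rV[R]_n => (`|v (x + z) - v (x + w)| `^ p)%:E).
Proof.
apply: measurable_funTS; apply/measurable_EFinP/measurable_pow_norm.
by apply: measurable_funB; apply: (measurableT_comp mv); exact: measurable_shift.
Qed.

(** The constant for [k] successive moves along the axes, when increments are added
    by means of [powR_add_le]. *)
Fixpoint stairs (k : nat) : R :=
  if k is k'.+1 then 2 `^ p * (1 + stairs k') else 0.

Let trunc z (k : nat) : 'rV[R]_n := \row_j (if (j < k)%N then z ord0 j else 0).

(** Move by [z] one coordinate at a time; all the intermediate cubes stay within
    [r + rho] of [c]. *)
Lemma translation_estimate c r rho s z : r + rho < s ->
  (forall i, `|z ord0 i| <= rho) -> ccube c s `<=` Omega ->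
  (\int[leb]_(x in qcube c r) (`|v (x + z) - v x| `^ p)%:E <=
    (stairs n * ((2 * rho) `^ p * M))%:E)%E.
Proof.
move=> rs zrho csO; set B := (2 * rho) `^ p * M.
have p0 : 0 <= p by rewrite ltW// (lt_trans ltr01).
have p_neq0 : p != 0 by rewrite gt_eqF// (lt_trans ltr01).
have mQ := measurable_qcube c r.
suff H k : (k <= n)%N -> (\int[leb]_(x in qcube c r)
    (`|v (x + trunc z k) - v x| `^ p)%:E <= (stairs k * B)%:E)%E.
  have := H n (leqnn n); rewrite (_ : trunc z n = z)//.
  by apply/rowP => j; rewrite mxE ltn_ord.
elim: k => [_|k IH kn].
  rewrite (_ : trunc z 0 = 0); last by apply/rowP => j; rewrite !mxE.
  under eq_integral => x _ do rewrite addr0 subrr normr0 powR0//.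
  by rewrite integral0 mul0r.
pose i := Ordinal kn; pose e : 'rV[R]_n := delta_mx ord0 i.
have truncS : trunc z k.+1 = trunc z k + z ord0 i *: e.
  apply/rowP => j; rewrite !mxE eqxx /= ltnS leq_eqVlt.
  have [->|/eqP ji] := j =P i; first by rewrite eqxx ltnn /= mulr1 add0r.
  by rewrite -[(j == k :> nat)]/(j == i) (negbTE ji) mulr0 addr0.
have step : (\int[leb]_(x in qcube c r)
    (`|v (x + trunc z k.+1)%R - v (x + trunc z k)%R| `^ p)%:E <= B%:E)%E.
  pose a := c - const_mx r + trunc z k; pose b := c + const_mx r + trunc z k.
  have := @ge0_integral_shift R n (trunc z k) _
    (fun y => (`|v (y + z ord0 i *: e) - v y| `^ p)%:E) (measurable_rbox a b).
  rewrite preimage_shift_rbox !addrK => H.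
  have -> : (\int[leb]_(x in qcube c r)
    (`|v (x + trunc z k.+1)%R - v (x + trunc z k)%R| `^ p)%:E =
    \int[leb]_(x in rbox a b) (`|v (x + z ord0 i *: e)%R - v x| `^ p)%:E)%E.
    rewrite -H; last 2 first.
    - have := @measurable_dv (rbox a b) (z ord0 i *: e) 0.
      by under eq_fun do rewrite addr0.
    - by move=> x _; rewrite lee_fin powR_ge0.
    by apply: eq_integral => x _; rewrite truncS addrA.
  have eta0 : 0 < s - r - rho by lra.
  apply: le_trans (translation_estimate_coord p1 intv (intg i) (@weak i) (gM i) eta0 _) _.
    apply: subset_trans csO => x h j; have := h j; rewrite !mxE eqxx /=.
    have := zrho i; have := zrho j; rewrite !ler_norml.
    have [->|/eqP ji] := j =P i.
      rewrite ltnn => _.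
      by case: (lerP 0 (z ord0 i)); rewrite /= ?mulr1; lra.
    by rewrite /= !mulr0; case: ifP => _; lra.
  rewrite lee_fin /B ler_wpM2r// ge0_ler_powR// ?nnegrE ?mulr_ge0//.
    exact: le_trans (zrho i).
  by rewrite ler_pM2l.
have IH' := IH (ltnW kn).
apply: (@le_trans _ _ (\int[leb]_(x in qcube c r) ((2 `^ p)%:E *
    ((`|v (x + trunc z k.+1)%R - v (x + trunc z k)%R| `^ p)%:E +
     (`|v (x + trunc z k)%R - v x| `^ p)%:E)))%E).
  have m2 w : measurable_fun (qcube c r) (fun x => (`|v (x + w)%R - v x| `^ p)%:E).
    have := @measurable_dv (qcube c r) w 0.
    by under eq_fun do rewrite addr0.
  apply: ge0_le_integral => //.
  - apply: emeasurable_funM; first exact: measurable_cst.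
    by apply: emeasurable_funD => //; exact: measurable_dv.
  move=> x _; rewrite -EFinD -EFinM lee_fin.
  rewrite -[v (x + trunc z k.+1) - v x](subrKA (v (x + trunc z k))).
  exact: powR_add_le.
have m2 : measurable_fun (qcube c r) (fun x => (`|v (x + trunc z k)%R - v x| `^ p)%:E).
  have := @measurable_dv (qcube c r) (trunc z k) 0.
  by under eq_fun do rewrite addr0.
rewrite ge0_integralZl_EFin ?powR_ge0//; last 2 first.
- by move=> x _; rewrite adde_ge0// lee_fin powR_ge0.
- by apply: emeasurable_funD => //; exact: measurable_dv.
rewrite ge0_integralD//; last exact: measurable_dv.
rewrite /= -mulrA mulrDl mul1r EFinM EFinD lee_wpmul2l ?lee_fin ?powR_ge0//.
exact: leeD.
Qed.

End translation_cube.

(** * Chains of points in a bounded connected set *)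

Section chains.
Context {R : realType} {n : nat}.
Implicit Types (x y z : 'rV[R]_n) (r : R) (U : set 'rV[R]_n).

Definition close r x y := forall i, `|x ord0 i - y ord0 i| < r.

Lemma close_sym r x y : close r x y -> close r y x.
Proof. by move=> h i; rewrite distrC. Qed.

Lemma close_trans r1 r2 x y z : close r1 x y -> close r2 y z -> close (r1 + r2) x z.
Proof.
move=> h1 h2 i; rewrite -(subrKA (y ord0 i)).
by rewrite (le_lt_trans (ler_normD _ _))// ltrD.
Qed.

Lemma close_refl r x : 0 < r -> close r x x.
Proof. by move=> r0 i; rewrite subrr normr0. Qed.

Lemma closeP r x y : 0 < r -> ball x r y <-> close r x y.
Proof.
move=> r0; split=> [[_ xy] i|xy]; first exact: xy.
by split=> // j i; rewrite ord1; exact: xy.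
Qed.

(** A bounded set is cut into finitely many cells of diameter less than [r]; their
    number does not depend on the set. *)
Lemma exists_cells (rho r : R) : 0 < r -> exists K (cell : 'rV[R]_n -> 'I_K),
  forall x y, (forall i, `|x ord0 i| < rho) -> (forall i, `|y ord0 i| < rho) ->
    cell x = cell y -> close r x y.
Proof.
move=> r0; pose m := Num.truncn (2 * rho / r).
pose c x : {ffun 'I_n -> 'I_m.+1} :=
  [ffun i => inord (Num.truncn ((x ord0 i + rho) / r))].
exists #|{ffun 'I_n -> 'I_m.+1}|, (enum_rank \o c).
move=> x y xr yr /enum_rank_inj /ffunP cxy i.
have tr z : `|z ord0 i| < rho -> (0 <= (z ord0 i + rho) / r) *
    (Num.truncn ((z ord0 i + rho) / r) < m.+1)%N.
  rewrite ltr_norml => /andP[z1 z2]; split.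
    by rewrite divr_ge0// ?(ltW r0)//; lra.
  by rewrite ltnS le_truncn// ler_pM2r ?invr_gt0//; lra.
have [x0 xm] := tr _ (xr i); have [y0 ym] := tr _ (yr i).
have := congr1 val (cxy i); rewrite !ffunE /= !inordK// => txy.
have /andP[x1 x2] := truncn_itv x0; have /andP[y1 y2] := truncn_itv y0.
rewrite txy in x1 x2.
have : `|(x ord0 i + rho) / r - (y ord0 i + rho) / r| < 1.
  by rewrite ltr_norml; move: x1 x2 y1 y2; rewrite -natr1; lra.
rewrite -mulrBl normrM normfV (gtr0_norm r0) ltr_pdivrMr// mul1r.
by rewrite opprD addrACA subrr addr0.
Qed.

(** A property that spreads between points of [U] at distance less than [2 r], at
    the price of one unit, reaches every point of a connected [U] at a price bounded
    by the number of cells: two cells are joined when they contain points of [U] at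
    distance less than [r], and a simple path visits no cell twice. *)
Lemma chain_propagation U (T : finType) (cell : 'rV[R]_n -> T) r
    (P : nat -> 'rV[R]_n -> Prop) : connected U -> 0 < r ->
  (forall x y, U x -> U y -> cell x = cell y -> close r x y) ->
  (forall m x y, U x -> U y -> close (2 * r) x y -> P m x -> P m.+1 y) ->
  forall x y, U x -> U y -> P 0%N x -> P #|T| y.
Proof.
move=> cU r0 cellr Pstep x0 y0 Ux0 Uy0 Px0.
pose e c c' := `[< exists x y, [/\ U x, U y, cell x = c, cell y = c' & close r x y] >].
have reach y : U y -> connect e (cell x0) (cell y).
  pose B := [set y | U y /\ connect e (cell x0) (cell y)].
  suff BU : B = U by rewrite -BU => -[].
  have near x y' : B x -> U y' -> close r x y' -> B y'.
    move=> [Ux cx] Uy xy; split => //; apply: connect_trans cx (connect1 _).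
    by apply/asboolP; exists x, y'.
  have openD (A : set 'rV[R]_n) : open (\bigcup_(x in A) ball x r).
    by apply: bigcup_open => x _; exact: ball_open.
  apply: cU.
  - by exists x0; split => //; exact: connect0.
  - exists (\bigcup_(x in B) ball x r) => //.
    rewrite eqEsubset; split=> [x Bx|x [Ux [x' Bx' /closeP xx']]].
      by split; [case: Bx|exists x => //; apply/closeP => //; exact: close_refl].
    by apply: near Bx' Ux _; exact: xx'.
  - exists (~` \bigcup_(x in U `\` B) ball x r); first exact: open_closedC.
    rewrite eqEsubset; split=> [x Bx|x [Ux xC]].
      split; first by case: Bx.
      move=> [x' [Ux' nBx'] /closeP xx']; apply: nBx'; apply: near Bx Ux' _.
      by apply: close_sym; exact: xx'.
    apply: contrapT => nBx; apply: xC; exists x; first by split.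
    by apply/closeP => //; exact: close_refl.
have same m x z : U x -> U z -> cell x = cell z -> P m x -> P m.+1 z.
  move=> Ux Uz xz; apply: Pstep => //.
  by move=> i; rewrite (lt_trans (cellr _ _ Ux Uz xz i))// ltr_pMl// ltr1n.
have Pmono m k x : U x -> P m x -> P (m + k)%N x.
  move=> Ux; elim: k => [|k IH] Pm; first by rewrite addn0.
  by rewrite addnS; apply: Pstep (IH Pm) => //; apply: close_refl; rewrite mulr_gt0.
have along s m x z : path e (cell x) s -> U x -> U z -> cell z = last (cell x) s ->
    P m x -> P (m + (size s).+1)%N z.
  elim: s m x => [|c s IH] m x /=.
    by move=> _ Ux Uz zx Px; rewrite addn1; exact: same Px.
  move=> /andP[/asboolP[x1 [y1 [Ux1 Uy1 x1x y1c x1y1]]] es] Ux Uz zl Px.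
  rewrite addnS -addSn; apply: (IH _ y1) => //; rewrite ?y1c//.
  apply: Pstep Px => //; rewrite mulr_natl mulr2n.
  by apply: close_trans x1y1; exact: cellr.
have /connectP[s es sl] := reach _ Uy0.
move: sl; case/shortenP: es => s' es' us' _ sl.
have := along _ _ _ _ es' Ux0 Uy0 sl Px0; rewrite add0n => Py0.
have le_s : ((size s').+1 <= #|T|)%N.
  by rewrite -[(size s').+1]/(size (cell x0 :: s')) -(card_uniqP us') max_card.
by rewrite -(subnKC le_s); exact: Pmono.
Qed.

End chains.

(** * Poincare inequality on cubes and on connected sets away from the boundary *)

Section mean_value.
Context {R : realType} d (T : measurableType d) (mu : {measure set T -> \bar R}).

Lemma exists_le_mean (D : set T) (f : T -> \bar R) (A c : R) :
  measurable D -> measurable_fun D f -> (forall x, D x -> (0 <= f x)%E) ->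
  0 <= A -> 0 < c -> mu D = c%:E -> (\int[mu]_(x in D) f x <= (A * c)%:E)%E ->
  exists2 x, D x & (f x <= A%:E)%E.
Proof.
move=> mD mf f0 A0 c0 muD intf; apply: contrapT => nf.
have fA x : D x -> (A%:E < f x)%E.
  by move=> Dx; rewrite ltNge; apply/negP => fx; apply: nf; exists x.
pose G x := (f x - A%:E)%E.
have mG : measurable_fun D G by apply: emeasurable_funB => //; exact: measurable_cst.
have G0 x : D x -> (0 < G x)%E by move=> Dx; rewrite sube_gt0; exact: fA.
have GE : (\int[mu]_(x in D) f x = (A * c)%:E + \int[mu]_(x in D) G x)%E.
  rewrite EFinM -muD -integral_cst// -ge0_integralD//; last first.
    by move=> x Dx; exact/ltW/G0.
  by apply: eq_integral => x _; rewrite /G addeC subeK.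
have intG0 : (\int[mu]_(x in D) `|G x| = 0)%E.
  have -> : (\int[mu]_(x in D) `|G x| = \int[mu]_(x in D) G x)%E.
    by apply: eq_integral => x; rewrite inE => Dx; rewrite gee0_abs// ltW// G0.
  apply/eqP; rewrite eq_le; apply/andP; split; last first.
    by apply: integral_ge0 => x Dx; exact/ltW/G0.
  move: intf; rewrite GE -[X in (_ <= X)%E]adde0.
  by rewrite leeD2lE.
have /(ae_eq_integral_abs mu mD mG) [B [mB muB nB]] := intG0.
have DB : D `<=` B.
  move=> x Dx; apply: nB => /= /(_ Dx) Gx; have := G0 _ Dx.
  by rewrite Gx ltxx.
have : (mu D <= mu B)%E by apply: le_measure; rewrite ?inE.
by rewrite muD muB lee_fin leNgt c0.
Qed.

End mean_value.

Section local_poincare.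
Context {R : realType} {n : nat}.
Notation leb := (@leb R n).
Implicit Types (c x y z : 'rV[R]_n) (r s : R).

Lemma leb_qcube c r : 0 <= r -> leb (qcube c r) = ((2 * r) ^+ n)%:E.
Proof.
move=> r0; rewrite leb_rbox; congr EFin.
rewrite (eq_bigr (fun=> 2 * r)) ?prodr_const ?card_ord// => i _.
rewrite !mxE (_ : _ - _ = 2 * r); last by ring.
by rewrite (max_idPr _)// mulr_ge0.
Qed.

Variables (Omega : set 'rV[R]_n) (v : 'rV[R]_n -> R) (p : R).
Variables (g : 'I_n -> 'rV[R]_n -> R) (M : R).
Hypothesis p1 : 1 < p.
Hypothesis intv : leb.-integrable setT (EFin \o v).
Hypothesis intg : forall i, leb.-integrable setT (EFin \o g i).
Hypothesis weak : forall i phi, test_function Omega phi ->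
  (\int[leb]_x (v x * partial i phi x)%:E = - \int[leb]_x (g i x * phi x)%:E)%E.
Hypothesis M0 : 0 <= M.
Hypothesis gM : forall i, (\int[leb]_x (`|g i x| `^ p)%:E <= M%:E)%E.

Let mv : measurable_fun setT v.
Proof. by apply/measurable_EFinP; exact: measurable_int intv. Qed.

Let p_ge0 : 0 <= p. Proof. by rewrite ltW// (lt_trans ltr01). Qed.

Let stairs_ge0 k : 0 <= stairs p k :> R.
Proof. by elim: k => //= k IH; rewrite mulr_ge0 ?powR_ge0// addr_ge0. Qed.

Let mvk k (D : set 'rV[R]_n) : measurable_fun D (fun x => (`|v x - k| `^ p)%:E).
Proof.
apply: measurable_funTS; apply/measurable_EFinP/measurable_pow_norm.
by apply: measurable_funB.
Qed.

(** The constant of [translation_estimate] for moves of size [2 r], which is the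
    only size used. *)
Definition cube_constant r : R := stairs p n * (4 * r) `^ p.

Let cube_constant_ge0 r : 0 <= cube_constant r.
Proof. by rewrite mulr_ge0 ?powR_ge0. Qed.

(** Integrate the translation estimate over all [z] in a cube of radius [2 r], which
    contains the differences of points of [qcube c r]. The constant is the value of
    [v] at a point [x0] where the integral of [|v (x0 + z) - v x0| ^ p] over [z] is at
    most its mean over the cube; [2 ^+ n] is the ratio of the two volumes. *)
Lemma poincare_cube c r s : 0 < r -> 3 * r < s -> ccube c s `<=` Omega ->
  exists k, (\int[leb]_(x in qcube c r) (`|v x - k| `^ p)%:E <=
    (2 ^+ n * cube_constant r * M)%:E)%E.
Proof.
move=> r0 rs csO.
have r20 : 0 <= 2 * r by rewrite mulr_ge0// ltW.
have q0 : 0 < (2 * r) ^+ n by rewrite exprn_gt0// mulr_gt0.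
have rs' : r + 2 * r < s by lra.
have A0 : 0 <= 2 ^+ n * cube_constant r * M.
  by rewrite mulr_ge0// mulr_ge0 ?exprn_ge0.
pose Q := qcube c r; pose Z : set 'rV[R]_n := qcube 0 (2 * r).
have mQ : measurable Q by exact: measurable_qcube.
have mZ : measurable Z by exact: measurable_qcube.
pose W (w : 'rV[R]_n * 'rV[R]_n) :=
  (`|v (w.1 + w.2) - v w.1| `^ p * \1_Q w.1 * \1_Z w.2)%:E.
have mW : measurable_fun setT W.
  apply/measurable_EFinP; apply: measurable_funM; last first.
    exact: (measurableT_comp (measurable_indic mZ) measurable_snd).
  apply: measurable_funM; last first.
    exact: (measurableT_comp (measurable_indic mQ) measurable_fst).
  apply: measurable_pow_norm; apply: measurable_funB; last first.
    exact: (measurableT_comp mv measurable_fst).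
  apply: (measurableT_comp mv); apply: measurable_rV => i.
  under eq_fun do rewrite mxE.
  apply: measurable_funD.
    exact: (measurableT_comp (measurable_coord i) measurable_fst).
  exact: (measurableT_comp (measurable_coord i) measurable_snd).
have W0 w : (0 <= W w)%E.
  by rewrite lee_fin /W !mulr_ge0 ?powR_ge0// indicE.
have indicr (f : 'rV[R]_n -> R) D :
    (\int[leb]_x (f x * \1_D x)%:E = \int[leb]_(x in D) (f x)%:E)%E.
  rewrite [RHS]integral_mkcond; apply: eq_integral => x _.
  by rewrite patchE indicE; case: ifPn => _; rewrite ?mulr1 ?mulr0.
have := @fubini_tonelli _ _ _ _ R (@sleb R n) (@sleb R n) W mW W0.
pose H x := (\int[leb]_(z in Z) (`|v (x + z) - v x| `^ p)%:E)%E.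
have FE x : fubini_F (@sleb R n) W x = if x \in Q then H x else 0%E.
  rewrite /fubini_F /W /= [\1_Q x]indicE; case: ifPn => _; last first.
    by apply: integral0_eq => z _; rewrite mulr0 mul0r.
  under eq_integral do rewrite mulr1.
  exact: indicr.
have mF : measurable_fun Q H.
  apply: (eq_measurable_fun (fubini_F (@sleb R n) W)).
    by move=> x xQ; rewrite FE xQ.
  by apply: measurable_funTS; exact: measurable_fun_fubini_tonelli_F.
have -> : (\int[sleb]_x \int[sleb]_y W (x, y) = \int[leb]_(x in Q) H x)%E.
  rewrite [RHS]integral_mkcond; apply: eq_integral => x _.
  by rewrite patchE -FE.
have -> : (\int[sleb]_z \int[sleb]_x W (x, z) = \int[leb]_(z in Z)
    \int[leb]_(x in Q) (`|v (x + z) - v x| `^ p)%:E)%E.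
  rewrite [RHS]integral_mkcond; apply: eq_integral => z _.
  rewrite patchE /W /= [\1_Z z]indicE; case: ifPn => _; last first.
    by apply: integral0_eq => x _; rewrite mulr0.
  by under eq_integral do rewrite mulr1; exact: indicr.
move=> HE.
have HQ : (\int[leb]_(x in Q) H x <=
    (2 ^+ n * cube_constant r * M * (2 * r) ^+ n)%:E)%E.
  rewrite HE.
  apply: (@le_trans _ _ (\int[leb]_(z in Z) (cube_constant r * M)%:E)%E).
    apply: (ge0_le_integral _ mZ).
    - by move=> z _; apply: integral_ge0 => x _; rewrite lee_fin powR_ge0.
    - apply: (eq_measurable_fun (fubini_G (@sleb R n) W)).
        move=> z zZ; rewrite /fubini_G /W /= [\1_Z z]indicE zZ.
        by under eq_integral do rewrite mulr1; exact: indicr.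
      by apply: measurable_funTS; exact: measurable_fun_fubini_tonelli_G.
    - exact: measurable_cst.
    move=> z Zz; have z2 i : `|z ord0 i| <= 2 * r.
      have /qcubeP/(_ i) := Zz; rewrite mxE ler_norml; lra.
    have := translation_estimate p1 intv intg weak M0 gM rs' z2 csO.
    rewrite (_ : stairs p n * _ = cube_constant r * M); first exact.
    by rewrite /cube_constant mulrA; congr (_ * _ `^ _ * _); ring.
  rewrite (integral_cst leb mZ) (leb_qcube 0 r20) -EFinM lee_fin exprMn.
  by rewrite le_eqVlt; apply/orP; left; apply/eqP; ring.
have H0 x : Q x -> (0 <= H x)%E.
  by move=> _; apply: integral_ge0 => z _; rewrite lee_fin powR_ge0.
have [x0 Qx0 Hx0] := exists_le_mean mQ mF H0 A0 q0 (leb_qcube c (ltW r0)) HQ.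
exists (v x0); apply: le_trans Hx0; move: HE HQ => _ _.
have := @ge0_integral_shift R n x0 Q (fun y => (`|v y - v x0| `^ p)%:E) mQ (@mvk _ _).
move=> <-; last by move=> y _; rewrite lee_fin powR_ge0.
rewrite /H; under [X in (_ <= X)%E]eq_integral => z _ do rewrite (addrC x0).
apply: (ge0_subset_integral _ (measurable_preimage_shift x0 mQ) mZ).
- apply: measurable_funTS.
  exact: (measurableT_comp (@mvk (v x0) setT) (measurable_shift x0)).
- by move=> z _; rewrite lee_fin powR_ge0.
- move=> z /= Qz; apply/qcubeP => i; rewrite mxE subr0.
  have /qcubeP/(_ i) := Qz; have /qcubeP/(_ i) := Qx0.
  by rewrite !mxE; lra.
Qed.

(** The constant [k] is kept when the cube is moved: compare [v] with its translate. *)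
Lemma cube_move c c' r s A k : 0 < r -> 3 * r < s -> close (2 * r) c c' ->
  ccube c s `<=` Omega ->
  (\int[leb]_(x in qcube c r) (`|v x - k| `^ p)%:E <= (A * M)%:E)%E ->
  (\int[leb]_(x in qcube c' r) (`|v x - k| `^ p)%:E <=
    (2 `^ p * (cube_constant r + A) * M)%:E)%E.
Proof.
move=> r0 rs cc' csO HA.
have mQ := measurable_qcube c r.
have qE : qcube c r = (fun x => x + (c' - c)) @^-1` qcube c' r.
  rewrite /qcube preimage_shift_rbox; congr rbox; apply/rowP => i; rewrite !mxE; ring.
rewrite -(ge0_integral_shift (c' - c) (measurable_qcube _ _) (@mvk k _)); last first.
  by move=> x _; rewrite lee_fin powR_ge0.
rewrite -qE.
have z2 i : `|(c' - c) ord0 i| <= 2 * r by rewrite !mxE distrC ltW.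
have rs' : r + 2 * r < s by lra.
have := translation_estimate p1 intv intg weak M0 gM rs' z2 csO.
rewrite (_ : stairs p n * _ = cube_constant r * M); last first.
  by rewrite /cube_constant mulrA; congr (_ * _ `^ _ * _); ring.
move=> HT.
have mT : measurable_fun (qcube c r) (fun x => (`|v (x + (c' - c)) - v x| `^ p)%:E).
  have := @measurable_dv R n v p intv (qcube c r) (c' - c) 0.
  by under eq_fun do rewrite addr0.
have mS : measurable_fun (qcube c r) (fun x => (`|v (x + (c' - c)) - k| `^ p)%:E).
  apply: measurable_funTS.
  exact: (measurableT_comp (@mvk k setT) (measurable_shift (c' - c))).
apply: (@le_trans _ _ (\int[leb]_(x in qcube c r) ((2 `^ p)%:E *
    ((`|v (x + (c' - c))%R - v x| `^ p)%:E + (`|v x - k| `^ p)%:E)))%E).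
  apply: ge0_le_integral => //.
  - apply: emeasurable_funM; first exact: measurable_cst.
    by apply: emeasurable_funD => //; exact: mvk.
  move=> x _; rewrite -EFinD -EFinM lee_fin.
  rewrite -[v (x + (c' - c)) - k](subrKA (v x)).
  exact: powR_add_le.
rewrite ge0_integralZl_EFin ?powR_ge0//; last 2 first.
- by move=> x _; rewrite adde_ge0// lee_fin powR_ge0.
- by apply: emeasurable_funD => //; exact: mvk.
rewrite ge0_integralD//.
rewrite -mulrA mulrDl EFinM EFinD; apply: lee_wpmul2l.
  by rewrite lee_fin powR_ge0.
exact: leeD HT HA.
Qed.

End local_poincare.

Section connected_poincare.
Context {R : realType} {n : nat}.
Notation leb := (@leb R n).

Lemma ge0_integral_bigsetU_le (f : 'rV[R]_n -> \bar R) (Q : nat -> set 'rV[R]_n) K :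
  measurable_fun setT f -> (forall x, (0 <= f x)%E) -> (forall i, measurable (Q i)) ->
  (\int[leb]_(x in \big[setU/set0]_(i < K) Q i) f x <=
   \sum_(i < K) \int[leb]_(x in Q i) f x)%E.
Proof.
move=> mf f0 mQ.
exact: (Boole_inequality (density_measure mf f0) (fun i _ => mQ i)).
Qed.

(** Start from the cube around one point of [U], keep its constant [k] and move the
    cube along chains of points of [U]. The set [V] is a union of cubes, one for each
    cell that meets [U]. The number [K] of cells depends on [rho], [r] and the dimension
    only, and it bounds both the length of the chains and the number of cubes. *)
Lemma poincare_connected (rho r p : R) : 0 < r -> 1 < p -> exists2 C, 0 <= C &
  forall (Omega : set 'rV[R]_n) v (g : 'I_n -> 'rV[R]_n -> R) (M : R),
  leb.-integrable setT (EFin \o v) ->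
  (forall i, leb.-integrable setT (EFin \o g i)) ->
  (forall i phi, test_function Omega phi ->
    (\int[leb]_x (v x * partial i phi x)%:E = - \int[leb]_x (g i x * phi x)%:E)%E) ->
  0 <= M -> (forall i, (\int[leb]_x (`|g i x| `^ p)%:E <= M%:E)%E) ->
  forall U : set 'rV[R]_n, connected U ->
  (forall x, U x -> forall i, `|x ord0 i| < rho) ->
  (forall x, U x -> ccube x (4 * r) `<=` Omega) ->
  exists k V, [/\ measurable V, U `<=` V, V `<=` Omega &
    (\int[leb]_(x in V) (`|v x - k| `^ p)%:E <= (C * M)%:E)%E].
Proof.
move=> r0 p1; have [K [cell cellP]] := @exists_cells R n rho r r0.
(* the constant after [m] moves *)
pose a m := iter m (fun A => 2 `^ p * (@cube_constant R n p r + A))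
  (2 ^+ n * @cube_constant R n p r).
have stairs0 k : 0 <= stairs p k :> R.
  by elim: k => //= k IH; rewrite mulr_ge0 ?powR_ge0// addr_ge0.
have cc0 : 0 <= @cube_constant R n p r by rewrite mulr_ge0 ?powR_ge0.
have a0 m : 0 <= a m.
  elim: m => [|m IH]; first by rewrite mulr_ge0// exprn_ge0.
  by rewrite /a iterS -/(a m) mulr_ge0 ?powR_ge0// addr_ge0.
exists (K%:R * a K); first by rewrite mulr_ge0.
move=> Omega v g M intv intg weak M0 gM U cU Ub UO.
have mv : measurable_fun setT v by apply/measurable_EFinP; exact: measurable_int intv.
have [[x0 Ux0]|U0] := pselect (U !=set0); last first.
  exists 0, set0; split => //.
  - by move=> x Ux; apply: U0; exists x.
  - by rewrite integral_set0 lee_fin !mulr_ge0.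
have r34 : 3 * r < 4 * r by rewrite ltr_pM2r// ltr_nat.
have [k Hk] := poincare_cube p1 intv intg weak M0 gM r0 r34 (UO _ Ux0).
pose f x := (`|v x - k| `^ p)%:E.
have f0 x : (0 <= f x)%E by rewrite lee_fin powR_ge0.
have mf : measurable_fun setT f.
  apply/measurable_EFinP/measurable_pow_norm.
  by apply: measurable_funB.
pose P m x := (\int[leb]_(y in qcube x r) f y <= (a m * M)%:E)%E.
have samecell x z : U x -> U z -> cell x = cell z -> close r x z.
  by move=> Ux Uz; apply: cellP; exact: Ub.
have Pstep m x z : U x -> U z -> close (2 * r) x z -> P m x -> P m.+1 z.
  move=> Ux Uz xz Pm.
  have := cube_move p1 intv intg weak M0 gM r0 r34 xz (UO _ Ux) Pm.
  by rewrite /P /a iterS.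
have Pall y : U y -> P K y.
  move=> Uy; have := chain_propagation cU r0 samecell Pstep Ux0 Uy Hk.
  by rewrite card_ord.
have Qex (i : nat) : exists Q : set 'rV[R]_n,
    [/\ measurable Q, Q `<=` Omega, forall x, U x -> cell x = i :> nat -> Q x &
        (\int[leb]_(y in Q) f y <= (a K * M)%:E)%E].
  have [[x [Ux xi]]|nx] := pselect (exists x, U x /\ cell x = i :> nat).
    exists (qcube x r); split; [exact: measurable_qcube| | |exact: Pall].
      apply: subset_trans (UO _ Ux) => y /qcubeP xy j.
      by have := xy j; rewrite !mxE; lra.
    move=> y Uy yi; apply/qcubeP => j.
    have yx : cell y = cell x by apply: val_inj; rewrite /= yi xi.
    have := cellP _ _ (Ub _ Uy) (Ub _ Ux) yx j.
    by rewrite ltr_norml; lra.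
  exists set0; split=> [|y []|x Ux xi|]; first exact: measurable0.
    by apply: nx; exists x.
  by rewrite integral_set0 lee_fin mulr_ge0.
have [Q QP] := choice Qex.
exists k, (\big[setU/set0]_(i < K) Q i); split.
- by apply: bigsetU_measurable => i _; have [] := QP i.
- move=> x Ux; rewrite -bigcup_mkord; exists (cell x : nat) => /=; first exact: ltn_ord.
  by have [_ _ H _] := QP (cell x); exact: H.
- rewrite -bigcup_mkord => x [i _]; have [_ H _ _] := QP i; exact: H.
- apply: (le_trans (ge0_integral_bigsetU_le K mf f0 _)).
    by move=> i; have [] := QP i.
  apply: (@le_trans _ _ (\sum_(i < K) (a K * M)%:E)%E).
    by apply: lee_sum => i _; have [] := QP i.
  by rewrite sumEFin sumr_const card_ord lee_fin -mulrA mulr_natl.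
Qed.

End connected_poincare.

Section euclidean.
Context {R : realType} {n : nat}.
Implicit Types (x y z : 'rV[R]_n) (s delta : R) (Omega : set 'rV[R]_n).

Lemma coord_le_enorm x i : `|x ord0 i| <= enorm x.
Proof.
rewrite -sqrtr_sqr ler_wsqrtr// (bigD1 i)//= lerDl.
by apply: sumr_ge0 => j _; exact: sqr_ge0.
Qed.

Lemma enorm_le_coord x s : (0 < n)%N -> 0 <= s -> (forall i, `|x ord0 i| <= s) ->
  enorm x <= n%:R * s.
Proof.
move=> n0 s0 xs; rewrite -[leRHS]ger0_norm ?mulr_ge0// -sqrtr_sqr ler_wsqrtr//.
apply: (@le_trans _ _ (\sum_(i < n) s ^+ 2)).
  by apply: ler_sum => i _; rewrite -[leLHS]real_normK ?num_real// ler_pXn2r ?nnegrE.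
rewrite sumr_const card_ord -[leLHS]mulr_natl exprMn ler_wpM2r ?exprn_ge0//.
by rewrite expr2 ler_peMl// ler1n.
Qed.

(** A segment from a point of [Omega] to a point outside meets the boundary. *)
Lemma inner_part_cube Omega delta s x : (0 < n)%N -> open Omega -> 0 <= s ->
  n%:R * s <= delta -> inner_part Omega delta x -> ccube x s `<=` Omega.
Proof.
move=> n0 oO s0 sd [Ox xd] y xy.
have xys i : `|(y - x) ord0 i| <= s.
  by have := xy i; rewrite !mxE ler_norml; lra.
pose gam (t : R) := x + t *: (y - x).
have cg : continuous gam.
  move=> t; apply: cvgD; first exact: cvg_cst.
  by apply: cvgZr_tmp.
pose B := [set t | t \in `[0, 1] /\ Omega (gam t)].
have nbd t : t \in `[0, 1] -> closure Omega (gam t) -> Omega (gam t).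
  rewrite in_itv /= => /andP[t0 t1] ct; apply: contrapT => nO.
  have : boundary Omega (gam t).
    by split => // /interior_subset.
  move=> bt; have : (edist_set x (boundary Omega) <= (enorm (x - gam t))%:E)%E.
    by apply: ereal_inf_lbound; exists (gam t).
  rewrite leNgt => /negP; apply; apply: le_lt_trans xd; rewrite lee_fin.
  apply: le_trans sd; apply: enorm_le_coord => // i.
  rewrite /gam opprD addrA subrr add0r mxE normrN mxE normrM ger0_norm//.
  by rewrite (le_trans _ (xys i))// ler_piMl.
have BE : B = `[0, 1]%classic.
  apply: segment_connected.
  - by exists 0; split; rewrite ?in_itv /= ?lexx ?ler01// /gam scale0r addr0.
  - exists (gam @^-1` Omega); first by apply: open_comp => // t _; exact: cg.
    by rewrite eqEsubset; split=> t [].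
  - exists (gam @^-1` closure Omega).
      by apply: closed_comp => [t _|]; [exact: cg|exact: closed_closure].
    rewrite eqEsubset; split=> t [t01 Ot]; split => //.
      exact: subset_closure.
    exact: nbd.
have : B 1 by rewrite BE /= in_itv /= ler01 lexx.
by move=> [_]; rewrite /gam scale1r addrC subrK.
Qed.

End euclidean.

(** * Test functions and Sobolev functions on bounded open sets *)

Section test_functions.
Context {R : realType} {n : nat}.
Notation mu := (@lebesgue_measure R).
Notation leb := (@leb R n).
Implicit Types (Omega : set 'rV[R]_n) (phi : 'rV[R]_n -> R) (i : 'I_n).

Lemma continuous_measurable_rV phi : continuous phi -> measurable_fun setT phi.
Proof.
move=> /continuousP cphi; apply: (measurability _ (RGenOInfty.measurableE R)).
move=> _ [_ [a ->] <-]; rewrite setTI; apply: open_measurable_rV.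
by apply: cphi; exact: interval_open.
Qed.

Lemma compact_sub_cube (K : set 'rV[R]_n) : compact K -> exists k, K `<=` cube k.
Proof.
move=> /compact_bounded [M [_ HM]].
exists (Num.truncn (M + 1)).+1 => x Kx; apply: in_cube => i.
apply: le_lt_trans (truncnS_gt (M + 1)).
have xM : `|x| <= M + 1 by apply: HM => //; rewrite ltrDl.
apply: le_trans xM; have -> : `|x| = mx_norm x by [].
by rewrite mx_normrE; apply/bigmax_geP; right; exists (ord0, i).
Qed.

Lemma compact_measurable (K : set 'rV[R]_n) : compact K -> measurable K.
Proof.
move=> cK; rewrite -[K]setCK; apply: measurableC; apply: open_measurable_rV.
by apply: closed_openC; apply: compact_closed cK; exact: norm_hausdorff.
Qed.

Lemma compact_support_bounded phi (K : set 'rV[R]_n) : continuous phi ->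
  compact K -> (forall x, ~ K x -> phi x = 0) ->
  exists2 B, 0 <= B & forall x, `|phi x| <= B.
Proof.
move=> cphi cK phi0.
have /compact_bounded [M [_ HM]] : compact (phi @` K).
  by apply: continuous_compact => //; exact: continuous_subspaceT.
exists (`|M| + 1) => [|x]; first by rewrite addr_ge0.
have [Kx|nKx] := pselect (K x); last by rewrite phi0// normr0 addr_ge0.
by apply: HM; [rewrite (le_lt_trans (ler_norm _))// ltrDl|exists x].
Qed.

Lemma bounded_integrable phi (A : set 'rV[R]_n) (B : R) : measurable A ->
  (leb A < +oo)%E -> measurable_fun A phi -> (forall x, A x -> `|phi x| <= B) ->
  leb.-integrable A (EFin \o phi).
Proof.
move=> mA Aoo mphi phiB; apply/integrableP; split; first exact/measurable_EFinP.
apply: (@le_lt_trans _ _ (\int[leb]_(x in A) B%:E)%E).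
  apply: ge0_le_integral => //.
  by apply/measurable_EFinP; exact: measurableT_comp.
rewrite integral_cst//.
have -> : leb A = (fine (leb A))%:E by rewrite fineK// ge0_fin_numE.
by rewrite -EFinM ltry.
Qed.

Lemma compact_support_integrable phi (K : set 'rV[R]_n) : continuous phi ->
  compact K -> (forall x, ~ K x -> phi x = 0) ->
  leb.-integrable setT (EFin \o phi).
Proof.
move=> cphi cK phi0; have mK := compact_measurable cK.
have [B _ phiB] := compact_support_bounded cphi cK phi0.
have [k Kk] := compact_sub_cube cK.
have -> : EFin \o phi = (EFin \o phi) \_ K.
  apply/funext => x; rewrite patchE; case: ifPn => // /negP xK /=.
  by rewrite phi0// => Kx; apply: xK; rewrite inE.
apply/(iffLR (integrable_mkcond _ mK)).
apply: (@bounded_integrable _ _ B) => //.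
- apply: le_lt_trans (leb_rbox_lty (const_mx (- k%:R)) (const_mx k%:R)).
  by apply: le_measure => //; rewrite inE//; exact: measurable_rbox.
- by apply: measurable_funTS; exact: continuous_measurable_rV.
Qed.

Section one_test_function.
Variables (Omega : set 'rV[R]_n) (phi : 'rV[R]_n -> R) (i : 'I_n).
Hypothesis tphi : test_function Omega phi.
Let e : 'rV[R]_n := delta_mx ord0 i.
Let K := closure [set x | phi x != 0].

Let cK : compact K. Proof. by case: tphi. Qed.

Lemma test_function_continuous : continuous phi.
Proof. by case: tphi => /(_ [::]) [H _] _ _; exact: H. Qed.

Lemma test_function_partial_continuous : continuous (partial i phi).
Proof. by case: tphi => /(_ [:: i]) [H _] _ _; exact: H. Qed.

Lemma test_function_derivable x : derivable phi x e.
Proof. by case: tphi => /(_ [::]) [_ H] _ _; exact: H. Qed.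

Lemma test_function_off x : ~ K x -> phi x = 0.
Proof.
move=> nKx; apply/eqP/negPn/negP => phix; apply: nKx.
exact: subset_closure.
Qed.

Lemma partial_test_function_off x : ~ K x -> partial i phi x = 0.
Proof.
move=> nKx; rewrite /partial.
rewrite (@near_eq_derive _ _ _ phi (cst 0)) ?derive_cst//.
have : nbhs x (~` K).
  by apply: open_nbhs_nbhs; split => //; exact/closed_openC/closed_closure.
by apply: filterS => y; exact: test_function_off.
Qed.

Lemma test_function_off_Omega x : ~ Omega x -> phi x = 0 /\ partial i phi x = 0.
Proof.
move=> nOx; have nKx : ~ K x by case: tphi => _ _ KO /KO.
by split; [exact: test_function_off|exact: partial_test_function_off].
Qed.

Let is_derive_line x (t : R) :
  is_derive t (1 : R) (fun t => phi (x + t *: e)) (partial i phi (x + t *: e)).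
Proof.
have d := @test_function_derivable (x + t *: e).
have qE : (fun h : R => h^-1 *: (((fun t => phi (x + t *: e)) \o shift t) (h *: 1) -
      phi (x + t *: e))) =
    (fun h : R => h^-1 *: ((phi \o shift (x + t *: e)) (h *: e) - phi (x + t *: e))).
  apply/funext => h /=; congr (_ *: (phi _ - _)).
  by rewrite -[h *: 1]/(h * 1) mulr1 scalerDl addrCA.
by apply: DeriveDef; rewrite /derivable /derive qE.
Qed.

(** The integral of a derivative along [e] is that of an increment
    [phi (x + e) - phi x], which translation invariance makes vanish. *)
Lemma integral_partial_test_function : (\int[leb]_x (partial i phi x)%:E = 0)%E.
Proof.
pose g := partial i phi.
have cg : continuous g := test_function_partial_continuous.
have intg : leb.-integrable setT (EFin \o g).
  by apply: compact_support_integrable cg cK _; exact: partial_test_function_off.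
have intphi : leb.-integrable setT (EFin \o phi).
  apply: compact_support_integrable test_function_continuous cK _.
  exact: test_function_off.
have one1 (x : 'rV[R]_n) : `|cst 1 x : R| <= 1 by rewrite normr1.
have m1 : measurable_fun setT (cst 1 : 'rV[R]_n -> R) by exact: measurable_cst.
have E1 : (\int[leb]_x \int[mu]_t (g x * cst 1 (x - t *: e)%R * \1_(`[0%R, 1%R]) t)%:E =
    \int[leb]_x (g x)%:E)%E.
  apply: eq_integral => x _; rewrite integral_time.
  transitivity (\int[mu]_(t in `[0%R, 1%R]) (cst (g x)%:E) t)%E.
    by apply: eq_integral => t _; rewrite /= mulr1.
  rewrite integral_cst// -[RHS]mule1; congr (_ * _)%E.
  exact: lebesgue_itv0.
have E2 : (\int[@line_product R n]_w
    (g (w.1 + w.2 *: e)%R * cst 1 w.1 * \1_(`[0%R, 1%R]) w.2)%:E =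
    \int[leb]_x (phi (x + e) - phi x)%:E)%E.
  rewrite -(@integral12_prod_meas1 _ _ _ _ R (@sleb R n) mu _
    (integrable_line_weight e ler01 intg m1 one1)).
  apply: eq_integral => x _; rewrite /fubini_F /=.
  transitivity (\int[mu]_(t in `[0%R, 1%R]) (g (x + t *: e))%:E)%E.
    by rewrite -integral_time; apply: eq_integral => t _; rewrite mulr1.
  have cl : continuous (fun t : R => x + t *: e).
    by move=> t; apply: cvgD; [exact: cvg_cst|apply: cvgZr_tmp].
  have cphil : continuous (fun t : R => phi (x + t *: e)).
    by move=> t; apply: continuous_comp; [exact: cl|exact: test_function_continuous].
  rewrite (@continuous_FTC2 _ _ (fun t : R => phi (x + t *: e)) 0 1)//.
  - by rewrite scale1r scale0r addr0 EFinB.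
  - apply: continuous_subspaceT => t.
    by apply: continuous_comp; [exact: cl|exact: cg].
  - split.
    + by move=> t _; exact: (@ex_derive _ _ _ _ _ _ _ (is_derive_line x t)).
    + exact/cvg_at_right_filter/cphil.
    + exact/cvg_at_left_filter/cphil.
  - by move=> t _; rewrite derive1E; exact: (@derive_val _ _ _ _ _ _ _ (is_derive_line x t)).
apply: (eq_trans (esym E1)); apply: (eq_trans (fubini_line e ler01 intg m1 one1)).
apply: (eq_trans E2); move: E1 E2 => _ _.
under eq_integral do rewrite EFinB.
have intphie := integrable_shift e measurableT intphi.
rewrite preimage_setT in intphie.
rewrite integralB_EFin//.
have := integral_shift e measurableT intphi; rewrite preimage_setT => H.
rewrite [X in (X - _)%E]H subee//.
by apply: integrable_fin_num.
Qed.

End one_test_function.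
End test_functions.

Section sobolev_functions.
Context {R : realType} {n : nat}.
Notation leb := (@leb R n).
Variables (Omega : set 'rV[R]_n) (p : R).
Hypothesis p1 : 1 < p.
Hypothesis oO : open Omega.
Hypothesis Ooo : (leb Omega < +oo)%E.

Let mO : measurable Omega. Proof. exact: open_measurable_rV. Qed.
Let p_gt0 : 0 < p. Proof. exact: lt_trans p1. Qed.

Lemma LpNorm_poweR q (u : 'rV[R]_n -> R) : 0 < q ->
  (LpNorm Omega q u `^ q = \int[leb]_(x in Omega) (`|u x| `^ q)%:E)%E.
Proof.
move=> q0; have q_neq0 : q != 0 by rewrite gt_eqF.
apply: (eq_trans (@poweR_Lnorm _ _ _ leb (EFin \o (u \_ Omega)) q q_neq0)).
apply: esym; rewrite [LHS]integral_mkcond; apply: eq_integral => x _.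
rewrite patchE /= patchE; case: ifPn => _; first by rewrite -poweR_EFin.
rewrite normr0; exact: esym (poweR0r q_neq0).
Qed.

Lemma in_LpP (u : 'rV[R]_n -> R) : in_Lp Omega p u <->
  measurable_fun Omega u /\ (\int[leb]_(x in Omega) (`|u x| `^ p)%:E < +oo)%E.
Proof.
rewrite -(LpNorm_poweR u p_gt0); split=> -[mu uoo]; split => //.
  exact: poweR_lty.
by apply: lty_poweRy uoo; rewrite gt_eqF.
Qed.

Lemma in_Lp_integrable (u : 'rV[R]_n -> R) :
  in_Lp Omega p u -> leb.-integrable Omega (EFin \o u).
Proof.
move=> /in_LpP [mu uoo]; apply/integrableP; split; first exact/measurable_EFinP.
have mup : measurable_fun Omega (fun x => (`|u x| `^ p)%:E).
  by apply/measurable_EFinP; exact: measurable_pow_norm.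
apply: (@le_lt_trans _ _ (\int[leb]_(x in Omega) ((`|u x| `^ p)%:E + 1))%E).
  apply: ge0_le_integral => //.
  - by apply/measurable_EFinP; exact: measurableT_comp.
  - by apply: emeasurable_funD => //; exact: measurable_cst.
  move=> x _; rewrite /= -EFinD lee_fin.
  have := @young_powR R p `|u x| 1 p1 (normr_ge0 _) ler01.
  by rewrite !powR1 mul1r.
rewrite ge0_integralD//.
rewrite lte_add_pinfty// integral_cst// mul1e.
exact: Ooo.
Qed.

Lemma integrable_restrict (u : 'rV[R]_n -> R) : leb.-integrable Omega (EFin \o u) ->
  leb.-integrable setT (EFin \o (u \_ Omega)).
Proof.
move=> intu; have -> : EFin \o (u \_ Omega) = (EFin \o u) \_ Omega.
  by apply/funext => x /=; rewrite !patchE; case: ifPn.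
exact: (iffLR (integrable_mkcond _ mO)).
Qed.

Let integrable_mul_bounded (u psi : 'rV[R]_n -> R) B : 0 <= B ->
  leb.-integrable Omega (EFin \o u) -> measurable_fun setT psi ->
  (forall x, `|psi x| <= B) ->
  leb.-integrable Omega (fun x => (u x * psi x)%:E).
Proof.
move=> B0 intu mpsi psiB; have mu := measurable_int _ intu.
have intBu : leb.-integrable Omega (fun x => B%:E * (EFin \o u) x)%E.
  exact: integrableZl.
apply: le_integrable intBu => //.
  apply/measurable_EFinP; apply: measurable_funM; first exact/measurable_EFinP.
  exact: measurable_funTS.
move=> x _; rewrite lee_fin !normrM (ger0_norm B0) mulrC.
by rewrite ler_wpM2r.
Qed.

Let integral_restrict_mul (u psi : 'rV[R]_n -> R) :
  (\int[leb]_x ((u \_ Omega) x * psi x)%:E = \int[leb]_(x in Omega) (u x * psi x)%:E)%E.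
Proof.
rewrite [RHS]integral_mkcond; apply: eq_integral => x _; rewrite !patchE.
by case: ifPn => // _; rewrite mul0r.
Qed.

Let test_integrable (u : 'rV[R]_n -> R) phi i : test_function Omega phi ->
  leb.-integrable Omega (EFin \o u) ->
  leb.-integrable Omega (fun x => (u x * phi x)%:E) /\
  leb.-integrable Omega (fun x => (u x * partial i phi x)%:E).
Proof.
move=> tphi intu; have [_ cK _] := tphi.
have cphi := test_function_continuous tphi.
have cdphi := @test_function_partial_continuous _ _ _ _ i tphi.
have [B B0 HB] := compact_support_bounded cphi cK (@test_function_off _ _ phi).
have [B' B'0 HB'] := compact_support_bounded cdphi cK
  (@partial_test_function_off _ _ phi i).
split.
  apply: (integrable_mul_bounded B0) => //; exact: continuous_measurable_rV.
apply: (integrable_mul_bounded B'0) => //; exact: continuous_measurable_rV.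
Qed.

(** Extending by 0 turns the weak derivative into an identity of convergent integrals
    over the whole space. *)
Lemma weak_partial_restrict u g i phi : in_Lp Omega p u -> in_Lp Omega p g ->
  weak_partial Omega u i g -> test_function Omega phi ->
  (\int[leb]_x ((u \_ Omega) x * partial i phi x)%:E =
    - \int[leb]_x ((g \_ Omega) x * phi x)%:E)%E.
Proof.
move=> Lu Lg wu tphi; rewrite !integral_restrict_mul.
have [_ int1] := test_integrable i tphi (in_Lp_integrable Lu).
have [int2 _] := test_integrable i tphi (in_Lp_integrable Lg).
have := wu _ tphi; rewrite /Rintegral => H.
rewrite -(fineK (integrable_fin_num mO int1)) H EFinN.
by rewrite fineK// (integrable_fin_num mO int2).
Qed.

(** Constants have weak gradient 0 because the integral of a derivative of a test
    function vanishes. *)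
Lemma W1p_subr_cst u Du (c : R) : W1p Omega p u Du ->
  W1p Omega p (fun x => u x - c) Du.
Proof.
move=> [Lu LDu]; split.
  have /in_LpP [mu uoo] := Lu; apply/in_LpP; split.
    exact: measurable_funB.
  have mup : measurable_fun Omega (fun x => (`|u x| `^ p)%:E).
    by apply/measurable_EFinP; exact: measurable_pow_norm.
  have p0 := ltW p_gt0.
  apply: (@le_lt_trans _ _ (\int[leb]_(x in Omega)
      ((2 `^ p)%:E * ((`|u x| `^ p)%:E + (`|- c| `^ p)%:E)))%E).
    apply: ge0_le_integral => //.
    - by apply/measurable_EFinP/measurable_pow_norm; exact: measurable_funB.
    - apply: emeasurable_funM; first exact: measurable_cst.
      by apply: emeasurable_funD => //; exact: measurable_cst.
    by move=> x _; rewrite -EFinD -EFinM lee_fin powR_add_le.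
  rewrite ge0_integralZl_EFin ?powR_ge0//; last 2 first.
  - by move=> x _; rewrite adde_ge0// lee_fin powR_ge0.
  - by apply: emeasurable_funD => //; exact: measurable_cst.
  rewrite ge0_integralD//.
  rewrite lte_mul_pinfty ?lee_fin ?powR_ge0// lte_add_pinfty// integral_cst//.
  by rewrite lte_mul_pinfty ?lee_fin ?powR_ge0.
move=> i; have [LDi wDi] := LDu i; split => // phi tphi.
have [_ int1] := test_integrable i tphi (in_Lp_integrable Lu).
have intc : leb.-integrable Omega (EFin \o (cst c : 'rV[R]_n -> R)).
  apply: (@bounded_integrable _ _ (cst c) _ `|c|) => //; exact: measurable_cst.
have [_ int2] := test_integrable i tphi intc.
have -> : (fun x => (u x - c) * partial i phi x) =
    (fun x => u x * partial i phi x - cst c x * partial i phi x).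
  by apply/funext => x; rewrite mulrBl.
rewrite RintegralB// (wDi _ tphi) -[RHS]subr0; congr (_ - _).
rewrite /Rintegral -(integral_restrict_mul (cst c)).
have -> : (\int[leb]_x (((cst c : 'rV[R]_n -> R) \_ Omega) x * partial i phi x)%:E =
    c%:E * \int[leb]_x (partial i phi x)%:E)%E.
  have intd : leb.-integrable setT (EFin \o partial i phi).
    have [_ cK _] := tphi.
    apply: (compact_support_integrable (@test_function_partial_continuous _ _ _ _ i tphi) cK).
    exact: partial_test_function_off.
  rewrite -integralZl//; apply: eq_integral => x _; rewrite patchE /=.
  case: ifPn => // /negP xO; rewrite mul0r.
  have [_ ->] := test_function_off_Omega i tphi (fun Ox => xO (mem_set Ox)).
  by rewrite mule0.
by rewrite (integral_partial_test_function i tphi) mule0.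
Qed.

End sobolev_functions.

(** * The uniform inequality *)

Section final_estimates.
Context {R : realType} d (T : measurableType d) (mu : {measure set T -> \bar R}).
Implicit Types (p q lam A eps k c : R) (D : set T) (f u : T -> R).

(** On a small set the [L^p] norm is controlled by the [L^q] norm, [q > p]: split
    according to whether [|f|] exceeds the level [lam]. *)
Lemma tail_estimate D f p q lam A eps : measurable D -> measurable_fun D f ->
  0 < p -> p < q -> 0 < lam -> (mu D <= eps%:E)%E ->
  (\int[mu]_(x in D) (`|f x| `^ q)%:E <= A%:E)%E ->
  (\int[mu]_(x in D) (`|f x| `^ p)%:E <= (lam `^ p * eps + lam `^ (p - q) * A)%:E)%E.
Proof.
move=> mD mf p0 pq lam0 muD fA.
have p_ge0 := ltW p0; have q0 : 0 < q := lt_trans p0 pq.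
have pqp : 0 <= q - p by rewrite subr_ge0 ltW.
have pointwise y : 0 <= y -> y `^ p <= lam `^ p + lam `^ (p - q) * y `^ q.
  move=> y0; have [yl|/ltW ly] := leP y lam.
    by rewrite -[leLHS]addr0 lerD ?ge0_ler_powR ?nnegrE ?mulr_ge0 ?powR_ge0// ltW.
  have yl := lt_le_trans lam0 ly.
  have -> : y `^ q = y `^ (q - p) * y `^ p.
    by rewrite -powRD ?subrK// gt_eqF//= implybT.
  have h : 1 <= lam `^ (p - q) * y `^ (q - p).
    rewrite -(opprB q p) powRN mulrC ler_pdivlMr ?powR_gt0// mul1r.
    by rewrite ge0_ler_powR ?nnegrE// ltW.
  rewrite mulrA (le_trans (ler_peMl _ h)) ?powR_ge0// lerDr powR_ge0//.
have mfp s : measurable_fun D (fun x => (`|f x| `^ s)%:E).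
  by apply/measurable_EFinP; exact: measurable_pow_norm.
have ge0 s x : (0 <= (`|f x| `^ s)%:E)%E by rewrite lee_fin powR_ge0.
apply: (@le_trans _ _ (\int[mu]_(x in D)
    ((lam `^ p)%:E + (lam `^ (p - q))%:E * (`|f x| `^ q)%:E))%E).
  apply: (ge0_le_integral _ mD).
  - by move=> x _; exact: ge0.
  - exact: mfp.
  - apply: emeasurable_funD; first exact: measurable_cst.
    by apply: emeasurable_funM; [exact: measurable_cst|exact: mfp].
  - by move=> x _; rewrite -EFinM -EFinD lee_fin pointwise.
rewrite ge0_integralD; first last.
- by apply: emeasurable_funM; [exact: measurable_cst|exact: mfp].
- by move=> x _; rewrite mule_ge0 ?ge0// lee_fin powR_ge0.
- exact: measurable_cst.
- by move=> x _; rewrite lee_fin powR_ge0.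
- exact: mD.
rewrite ge0_integralZl_EFin; first last.
- exact: powR_ge0.
- exact: mfp.
- by move=> x _; exact: ge0.
- exact: mD.
rewrite (integral_cst mu mD) EFinD !EFinM; apply: leeD.
  by apply: lee_wpmul2l muD; rewrite lee_fin powR_ge0.
by apply: lee_wpmul2l fA; rewrite lee_fin powR_ge0.
Qed.

(** If [u] has mean zero, then the mean of [u - k] is [- k], so that Jensen bounds
    [|k|] by the norm of [u - k]. *)
Lemma mean_zero_estimate D u p k c : measurable D -> mu D = c%:E -> 1 < p ->
  mu.-integrable D (EFin \o u) -> (\int[mu]_(x in D) (u x)%:E = 0)%E ->
  (\int[mu]_(x in D) (`|u x| `^ p)%:E <=
    (2 `^ p * (1 + 2 `^ p))%:E * \int[mu]_(x in D) (`|u x - k| `^ p)%:E)%E.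
Proof.
move=> mD muD p1 intu u0; have p0 : 0 < p := lt_trans ltr01 p1.
have p_ge0 := ltW p0.
have mu' : measurable_fun D u by apply/measurable_EFinP; exact: measurable_int intu.
have mw : measurable_fun D (fun x => u x - k) by exact: measurable_funB.
have mwp : measurable_fun D (fun x => (`|u x - k| `^ p)%:E).
  by apply/measurable_EFinP; exact: measurable_pow_norm.
have mup : measurable_fun D (fun x => (`|u x| `^ p)%:E).
  by apply/measurable_EFinP; exact: measurable_pow_norm.
have muoo : (mu D < +oo)%E by rewrite muD ltry.
have c0 : 0 <= c by rewrite -lee_fin -muD.
have intk : mu.-integrable D (fun=> k%:E).
  apply/integrableP; split; first exact: measurable_cst.
  by rewrite integral_cst// muD -EFinM ltry.
have mean : ((2 * (`|k| / 2) * c)%:E <= \int[mu]_(x in D) `|u x - k|%:E)%E.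
  have -> : (2 * (`|k| / 2) * c)%:E = `|\int[mu]_(x in D) (u x - k)%:E|%E.
    under eq_integral do rewrite EFinB.
    rewrite integralB//= u0 integral_cst// muD sub0e abseN -EFinM /=.
    by rewrite normrM (ger0_norm c0); congr EFin; field.
  apply: le_abse_integral => //; exact/measurable_EFinP.
have k20 : 0 <= `|k| / 2 by rewrite divr_ge0.
have kc := weak_jensen mD mw muD p1 k20 mean.
apply: (@le_trans _ _ (\int[mu]_(x in D)
    ((2 `^ p)%:E * ((`|u x - k| `^ p)%:E + (`|k| `^ p)%:E)))%E).
  apply: (ge0_le_integral _ mD).
  - by move=> x _; rewrite lee_fin powR_ge0.
  - exact: mup.
  - apply: emeasurable_funM; first exact: measurable_cst.
    by apply: emeasurable_funD; [exact: mwp|exact: measurable_cst].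
  - move=> x _; rewrite -EFinD -EFinM lee_fin -{1}(subrK k (u x)).
    exact: powR_add_le.
rewrite ge0_integralZl_EFin; first last.
- exact: powR_ge0.
- by apply: emeasurable_funD; [exact: mwp|exact: measurable_cst].
- by move=> x _; rewrite adde_ge0// lee_fin powR_ge0.
- exact: mD.
rewrite ge0_integralD; first last.
- exact: measurable_cst.
- by move=> x _; rewrite lee_fin powR_ge0.
- exact: mwp.
- by move=> x _; rewrite lee_fin powR_ge0.
- exact: mD.
rewrite (integral_cst mu mD) muD EFinM -muleA; apply: lee_wpmul2l.
  by rewrite lee_fin powR_ge0.
rewrite EFinD ge0_muleDl ?lee_fin ?powR_ge0 ?ler01//.
rewrite mul1e; apply: leeD2l.
have -> : ((`|k| `^ p)%:E * c%:E = (2 `^ p)%:E * ((`|k| / 2) `^ p * c)%:E)%E.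
  rewrite -!EFinM mulrA -powRM//; congr (_ `^ _ * _)%:E.
  by field.
by apply: lee_wpmul2l kc; rewrite lee_fin powR_ge0.
Qed.

End final_estimates.

Section uniform.
Context {R : realType} {n : nat}.
Notation leb := (@leb R n).
Implicit Types (Omega V : set 'rV[R]_n) (p q C CS K : R).

Lemma measurable_enorm (D : set 'rV[R]_n) (f : 'rV[R]_n -> 'rV[R]_n) :
  (forall i, measurable_fun D (fun x => f x ord0 i)) ->
  measurable_fun D (fun x => enorm (f x)).
Proof.
move=> mf; have ms : measurable_fun setT (@Num.sqrt R).
  by apply: continuous_measurable_fun => x; exact: sqrt_continuous.
apply: (measurableT_comp ms); apply: measurable_sum => i.
by apply: measurable_funX.
Qed.

(** A level [lam] and a bound on the volume of [Omega \ V] that let the tail be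
    absorbed: with [lam = K lam0], [lam0 ^ p = CS ^ p (X + M)], both terms of
    the tail estimate are [(X + M) / 4]. *)
Lemma absorb_tail Omega V (w : 'rV[R]_n -> R) p q CS C (M X : R) :
  measurable Omega -> measurable V -> V `<=` Omega -> measurable_fun Omega w ->
  1 < p -> p < q -> 0 < CS -> 0 <= C -> 0 <= M ->
  let K := (4 * CS `^ p) `^ (q - p)^-1 in
  (leb (Omega `\` V) <= ((4 * CS `^ p * K `^ p)^-1)%:E)%E ->
  (\int[leb]_(x in V) (`|w x| `^ p)%:E <= (C * M)%:E)%E ->
  (\int[leb]_(x in Omega) (`|w x| `^ p)%:E = X%:E)%E ->
  (\int[leb]_(x in Omega) (`|w x| `^ q)%:E <=
    ((CS * (X + M) `^ p^-1) `^ q)%:E)%E ->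
  X <= (2 * C + 1) * M.
Proof.
move=> mO mV VO mw p1 pq CS0 C0 M0 K small wV wX wq.
have p0 : 0 < p := lt_trans ltr01 p1.
have p_ge0 := ltW p0; have p_neq0 : p != 0 by rewrite gt_eqF.
have ge0 s x : (0 <= (`|w x| `^ s)%:E)%E by rewrite lee_fin powR_ge0.
have mwp : measurable_fun Omega (fun x => (`|w x| `^ p)%:E).
  by apply/measurable_EFinP; exact: measurable_pow_norm.
have X0 : 0 <= X by rewrite -lee_fin -wX integral_ge0.
have c0 : 0 < CS `^ p by rewrite powR_gt0.
have c4 : 0 < 4 * CS `^ p by rewrite mulr_gt0.
have K0 : 0 < K by rewrite powR_gt0.
have qp0 : q - p != 0 by rewrite gt_eqF// subr_gt0.
have KE : K `^ (p - q) = (4 * CS `^ p)^-1.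
  rewrite -(opprB q p) -mulN1r /K -powRrM mulrCA mulVf// mulr1.
  by rewrite powR_inv1// ltW.
have [XM0|XM0] := leP (X + M) 0.
  have -> : X = 0 by lra.
  by rewrite mulr_ge0// addr_ge0// mulr_ge0.
pose lam0 := CS * (X + M) `^ p^-1.
have lam00 : 0 < lam0 by rewrite mulr_gt0// powR_gt0.
have lam0p : lam0 `^ p = CS `^ p * (X + M).
  by rewrite powRM ?powR_ge0 ?(ltW CS0)// -powRrM mulVf// powRr1// ltW.
have mZ : measurable (Omega `\` V) by exact: measurableD.
have ZO : Omega `\` V `<=` Omega by move=> x [].
have wqZ : (\int[leb]_(x in Omega `\` V) (`|w x| `^ q)%:E <= (lam0 `^ q)%:E)%E.
  apply: le_trans wq; apply: (ge0_subset_integral _ mZ mO) => //.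
  by apply/measurable_EFinP; exact: measurable_pow_norm.
have lamK : 0 < K * lam0 by rewrite mulr_gt0.
have tail := tail_estimate mZ (measurable_funS mO ZO mw) p0 pq lamK small wqZ.
have tailE : (K * lam0) `^ p * (4 * CS `^ p * K `^ p)^-1 +
    (K * lam0) `^ (p - q) * lam0 `^ q = (X + M) / 2.
  have lamq : lam0 `^ (p - q) * lam0 `^ q = lam0 `^ p.
    by rewrite -powRD ?subrK// gt_eqF//= implybT.
  rewrite !(powRM _ (ltW K0) (ltW lam00)) KE -[_ * lam0 `^ q]mulrA lamq lam0p.
  have Kp : K `^ p != 0 by rewrite gt_eqF// powR_gt0.
  by field; rewrite gt_eqF.
rewrite tailE in tail.
have : (X%:E <= (C * M)%:E + ((X + M) / 2)%:E)%E.
  rewrite -wX -{1}(setDUK VO) ge0_integral_setU//.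
  - exact: leeD wV tail.
  - by rewrite setDUK.
  - by apply/disj_set2P; rewrite setDIK.
rewrite -EFinD lee_fin; lra.
Qed.

End uniform.

Theorem theorem3p1 (R : realType) (N : nat) (hN : (0 < N)%N)
  (p : R) (hp : 1 < p)
  (F : set (set 'rV[R]_N)) (hF : forall Omega, F Omega -> domain Omega)
  (f1 : exists r : R, 0 < r /\ forall Omega, F Omega -> Omega `<=` eball0 r)
  (f2 : exists q CS : R, [/\ p < q, 0 < CS &
    forall Omega, F Omega -> forall u Du, W1p Omega p u Du ->
      (LpNorm Omega q u <= CS%:E * W1pNorm Omega p u Du)%E])
  (f3 : forall eps : R, 0 < eps -> exists delta : R, 0 < delta /\
    forall Omega, F Omega -> exists U : set 'rV[R]_N,
      [/\ connected U, U `<=` Omega, U `<=` inner_part Omega delta &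
        (vol (Omega `\` U) < eps%:E)%E]) :
  exists C : R, 0 < C /\
    forall Omega, F Omega -> forall u Du, W1p Omega p u Du ->
      (\int[leb N]_(x in Omega) (u x)%:E = 0)%E ->
      (\int[leb N]_(x in Omega) (`|u x| `^ p)%:E <=
        C%:E * \int[leb N]_(x in Omega) (enorm (Du x) `^ p)%:E)%E.
Proof.
have p0 : 0 < p := lt_trans ltr01 hp.
case: f1 => rho [rho0 Frho]; case: f2 => q [CS [pq CS0 sobolev]].
pose K := (4 * CS `^ p) `^ (q - p)^-1.
have K0 : 0 < K by rewrite powR_gt0// mulr_gt0// powR_gt0.
have eps0 : 0 < (4 * CS `^ p * K `^ p)^-1.
  by rewrite invr_gt0 mulr_gt0 ?powR_gt0// mulr_gt0// powR_gt0.
have [delta [delta0 Fdelta]] := f3 _ eps0.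
have N0 : 0 < N%:R :> R by rewrite ltr0n.
(* cubes of radius [4 r] around the points of [U] stay in [Omega]: their points are
   at Euclidean distance at most [N * (4 r) = delta] from the centre *)
pose r := delta / (4 * N%:R); have r0 : 0 < r by rewrite divr_gt0// mulr_gt0.
have [C0 C0_ge0 core] := @poincare_connected R N rho r p r0 hp.
have k1 : 0 < 2 `^ p * (1 + 2 `^ p) :> R.
  by rewrite mulr_gt0 ?powR_gt0// addr_gt0// powR_gt0.
have k2 : 0 < 2 * C0 + 1 by rewrite ltr_wpDl// mulr_ge0.
exists (2 `^ p * (1 + 2 `^ p) * (2 * C0 + 1)); split; first exact: mulr_gt0.
move=> Omega FO u Du uDu u0.
have [_ _ oO] := hF _ FO.
have mO : measurable Omega by exact: open_measurable_rV.
have Ob x : Omega x -> forall i, `|x ord0 i| < rho.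
  by move=> Ox i; apply: le_lt_trans (coord_le_enorm x i) _; exact: Frho FO _ Ox.
have Ooo : (leb N Omega < +oo)%E.
  apply: le_lt_trans (leb_rbox_lty (const_mx (- rho)) (const_mx rho)).
  apply: le_measure; rewrite ?inE//; first exact: measurable_rbox.
  by move=> x Ox i; have := Ob _ Ox i; rewrite !mxE ltr_norml => /andP[-> /ltW].
have mDu i : measurable_fun Omega (fun x => Du x ord0 i).
  by case: uDu => _ /(_ i) [[]].
have mgrad : measurable_fun Omega (fun x => (enorm (Du x) `^ p)%:E).
  apply/measurable_EFinP; apply: (measurableT_comp (measurable_powR p)).
  exact: measurable_enorm.
have enorm0 x : (0 <= (enorm (Du x) `^ p)%:E)%E by rewrite lee_fin powR_ge0.
have Y0 : (0 <= \int[leb N]_(x in Omega) (enorm (Du x) `^ p)%:E)%E by exact: integral_ge0.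
(* an infinite right-hand side leaves nothing to prove *)
case YE : (\int[leb N]_(x in Omega) (enorm (Du x) `^ p)%:E)%E Y0 => [M| |] // M0;
  last by rewrite gt0_muley ?leey// lte_fin mulr_gt0.
rewrite lee_fin in M0.
have intg i : (leb N).-integrable Omega (EFin \o (fun x => Du x ord0 i)).
  by apply: (in_Lp_integrable hp oO Ooo); case: uDu => _ /(_ i) [].
have intu : (leb N).-integrable Omega (EFin \o u).
  by apply: (in_Lp_integrable hp oO Ooo); case: uDu.
have gM i : (\int[leb N]_x (`|((fun x => Du x ord0 i) \_ Omega) x| `^ p)%:E <= M%:E)%E.
  have -> : (\int[leb N]_x (`|((fun x => Du x ord0 i) \_ Omega) x| `^ p)%:E =
      \int[leb N]_(x in Omega) (`|Du x ord0 i| `^ p)%:E)%E.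
    apply: esym; rewrite [LHS]integral_mkcond; apply: eq_integral => x _.
    rewrite !patchE; case: ifPn => // _.
    by rewrite normr0 powR0// gt_eqF.
  rewrite -YE; apply: (ge0_le_integral _ mO).
  - by move=> x _; rewrite lee_fin powR_ge0.
  - by apply/measurable_EFinP; exact: measurable_pow_norm.
  - exact: mgrad.
  move=> x _; rewrite lee_fin ge0_ler_powR ?(ltW p0) ?nnegrE ?sqrtr_ge0//.
  exact: coord_le_enorm.
have weak i phi : test_function Omega phi ->
  (\int[leb N]_x ((u \_ Omega) x * partial i phi x)%:E =
   - \int[leb N]_x (((fun x => Du x ord0 i) \_ Omega) x * phi x)%:E)%E.
  case: uDu => Lu /(_ i) [LDu wDu] tphi.
  exact: (weak_partial_restrict hp oO Ooo Lu LDu wDu tphi).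
have [U [cU UO UI volU]] := Fdelta _ FO.
have UOcube x : U x -> ccube x (4 * r) `<=` Omega.
  move=> Ux; apply: (inner_part_cube hN oO _ _ (UI _ Ux)).
    by rewrite mulr_ge0// ltW.
  by rewrite /r le_eqVlt; apply/orP; left; apply/eqP; field; rewrite gt_eqF.
have [k [V [mV UV VO wV]]] := core Omega (u \_ Omega)
  (fun i => (fun x => Du x ord0 i) \_ Omega) M
  (integrable_restrict oO intu) (fun i => integrable_restrict oO (intg i))
  weak M0 gM U cU (fun x Ux => Ob _ (UO _ Ux)) UOcube.
have W := W1p_subr_cst hp oO Ooo k uDu.
pose w x := u x - k.
have [mw wfin] := iffLR (in_LpP Omega hp w) (proj1 W).
have ge0 s x : (0 <= (`|w x| `^ s)%:E)%E by rewrite lee_fin powR_ge0.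
have X0 : (0 <= \int[leb N]_(x in Omega) (`|w x| `^ p)%:E)%E by exact: integral_ge0.
case XE : (\int[leb N]_(x in Omega) (`|w x| `^ p)%:E)%E X0 wfin => [X| |] // X0 _.
have wVu : (\int[leb N]_(x in V) (`|w x| `^ p)%:E <= (C0 * M)%:E)%E.
  apply: le_trans wV; rewrite le_eqVlt; apply/orP; left; apply/eqP.
  by apply: eq_integral => x; rewrite inE => /VO Ox; rewrite patchE mem_set.
have small : (leb N (Omega `\` V) <= ((4 * CS `^ p * K `^ p)^-1)%:E)%E.
  apply: ltW; apply: le_lt_trans volU.
  rewrite /vol -(measurable_mu_extE (leb N) (measurableD mO mV)).
  by apply: le_mu_ext; exact: setDS.
have q0 : 0 < q := lt_trans p0 pq.
have wq : (\int[leb N]_(x in Omega) (`|w x| `^ q)%:E <=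
    ((CS * (X + M) `^ p^-1) `^ q)%:E)%E.
  rewrite -(LpNorm_poweR _ _ q0) -poweR_EFin.
  have wS := sobolev _ FO _ _ W.
  rewrite /W1pNorm XE YE -EFinD poweR_EFin -EFinM in wS.
  by apply: gt0_ler_poweR wS; rewrite ?(ltW q0)// in_itv /= leey andbT
    ?Lnorm_ge0// lee_fin mulr_ge0 ?powR_ge0// ltW.
have XM : X <= (2 * C0 + 1) * M.
  exact: (absorb_tail mO mV VO mw hp pq CS0 C0_ge0 M0 small wVu XE wq).
have muO : leb N Omega = (fine (leb N Omega))%:E by rewrite fineK// ge0_fin_numE.
apply: (le_trans (mean_zero_estimate k mO muO hp intu u0)).
by rewrite XE -EFinM lee_fin -[leRHS]mulrA ler_pM2l.
Qed.
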